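(* Let the game tree, the loss function $\lambda:L\to[0,1]$, the functions $n,m,\beta$, and the algorithm DP-EFB be as in the context, with $T\ge 1$ trials and privacy parameter $\epsilon\in(0,1)$. Let $\mu_1,\dots,\mu_T$ be arbitrary environments fixed in advance. Then the regret $$R:=\mathbb{E}\Big[\sum_{t=1}^T \ell_t\Big]-\min_{\sigma\in\mathcal S}\sum_{t=1}^T\Lambda(\sigma,\mu_t)$$ satisfies $$R\le 1+2\sqrt{\left(\frac{6\ln T}{\epsilon}+\frac{9(e-2)}{\epsilon^2}\right)|\mathcal A|\,\ln(|\mathcal S|)\,T}\,.$$
   Context: Game tree: $V$ is the node set of a finite rooted tree with root $r$ and leaf set $L$; $C(v)$ denotes the set of children of $v$ and $p(v)$ the parent of $v\neq r$. The internal nodes $V\setminus L$ are partitioned into a set $N$ of infosets and a set $\mathcal A$ of actions such that $r\in N$, $C(v)\subseteq\mathcal A$ and $|C(v)|>1$ for every $v\in N$, and $C(a)\subseteq N\cup L$ for every $a\in\mathcal A$. A loss function $\lambda:L\to[0,1]$ is fixed. A (pure) strategy is a map $\sigma:N\to V$ with $\sigma(v)\in C(v)$ for all $v\in N$; an environment is a map $\mu:\mathcal A\to V$ with $\mu(a)\in C(a)$ for all $a\in\mathcal A$. For a strategy $\sigma$, $V(\sigma)$ is the smallest subset of $V$ containing $r$, containing $\sigma(v)$ for every $v\in N\cap V(\sigma)$, and containing $C(a)$ for every $a\in\mathcal A\cap V(\sigma)$. The reduced strategy of $\sigma$ is the restriction of $\sigma$ to $N\cap V(\sigma)$ (with $V$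 of it defined as $V(\sigma)$); $\mathcal S$ is the set of all reduced strategies. For $\sigma\in\mathcal S$ write $N(\sigma)=N\cap V(\sigma)$, $\mathcal A(\sigma)=\mathcal A\cap V(\sigma)$. Playing a pair $(\sigma,\mu)$, $\sigma\in\mathcal S$, $\mu$ an environment, traverses the root-to-leaf path starting at $r$, moving from $v\in N$ to $\sigma(v)$ and from $a\in\mathcal A$ to $\mu(a)$, stopping at a leaf $u$; the loss is $\Lambda(\sigma,\mu):=\lambda(u)$, and the last action on this path is called the last action encountered. Functions $n,m:N\cup\mathcal A\to\mathbb N$ are defined recursively from the bottom of the tree: for $a\in\mathcal A$, $n(a)=\prod_{v\in C(a)\cap N}n(v)$ and $m(a)=1+\sum_{v\in C(a)\cap N}m(v)$ (empty product $=1$, empty sum $=0$); for $v\in N$, $n(v)=\sum_{a\in C(v)}n(a)$ and $m(v)=\sum_{a\in C(v)}m(a)$. The function $\beta:N\cup\mathcal A\to\mathbb R$ is defined from the top: $\beta(r)=1$, $\beta(a)=m(a)\beta(p(a))$ for $a\in\mathcal A$, $\beta(v)=\beta(p(v))/m(v)$ for $v\in N\setminus\{r\}$. Algorithm DP-EFB (parameters $T$, $\epsilon\in(0,1)$): set $\eta:=\left(\left(\frac{6\ln T}{\epsilon}+\frac{9(e-2)}{\epsilon^2}\right)\frac{m(r)T}{\ln n(r)}\right)^{-1/2}$ and $\gamma:=6\ln(T)\eta/\epsilon$. A policy is a map $\pi:\mathcal A\to[0,1]$ with $\sum_{a\in C(v)}\pi(a)=1$ for all $v\in N$. Initially $\pi_1(a):=n(a)/n(p(a))$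 for all $a\in\mathcal A$. For $a\in\mathcal A$, let $q_t(a)$ be the product of $\pi_t(a')$ over all actions $a'$ on the path from $r$ to $a$ (including $a$). On each trial $t=1,\dots,T$: (i) the server samples $\sigma_t\in\mathcal S$ recursively: starting at $r$, at each visited infoset $v$ it draws $\sigma_t(v)\in C(v)$ with $\Pr[\sigma_t(v)=a]=\pi_t(a)$ independently, and then visits every $v'\in C(\sigma_t(v))\cap N$. (ii) $(\sigma_t,\mu_t)$ is played, giving loss $\ell_t:=\Lambda(\sigma_t,\mu_t)$; let $z_t$ be the last action encountered. (iii) For each $a\in\mathcal A(\sigma_t)$, independently draw $\phi_t(a)$ from the Laplace density $Q(x)=\frac{\epsilon}{4}\exp(-\frac{\epsilon}{2}|x|)$ and set $d_t(a):=[a=z_t]\,\ell_t+\phi_t(a)$ (where $[P]$ is $1$ if $P$ holds and $0$ otherwise); $d_t:\mathcal A(\sigma_t)\to\mathbb R$ is sent to the server. (iv) The server runs $\mathrm{Update}_t(r,1)$, where for $v\in N(\sigma_t)$ and $x>0$, $\mathrm{Update}_t(v,x)$ does: let $b:=\sigma_t(v)$; for each $v'\in C(b)\cap N$ run $\mathrm{Update}_t(v',\pi_t(b)x)$ and call its return value $\psi_t(v')$; set $\omega_t(v):=\exp\!\left(\frac{-\eta\, d_t(b)}{\gamma\beta(b)+\pi_t(b)x}\right)\prod_{v'\in C(b)\cap N}\psi_t(v')$; for all $a\in C(v)$ set $\pi_{t+1}(a):=\frac{[a=b]\,\omega_t(v)\pi_t(a)+[a\ne b]\,\pi_t(a)}{1-(1-\omega_t(v))\pi_t(b)}$;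 return $\psi_t(v):=1-(1-\omega_t(v))\pi_t(b)$. For every $v\in N\setminus N(\sigma_t)$, $\pi_{t+1}(a):=\pi_t(a)$ for all $a\in C(v)$. Expectations are over all randomness of the algorithm. *)

(* Defs.v *)
From HB Require Import structures.
From mathcomp Require Import all_boot all_order all_algebra.
From mathcomp Require Import all_classical all_reals all_analysis.
Set Implicit Arguments. Unset Strict Implicit. Unset Printing Implicit Defensive.
Import Order.TTheory GRing.Theory Num.Theory.
Local Open Scope ring_scope.

Record gameTree := GameTree {
  node : finType;
  root : node;
  par : node -> node;
  isInfo : pred node;
  par_root : par root = root;
  reach_root : forall v : node, exists k, iter k par v = root;
  info_root : isInfo root;
  info_children : forall v w, isInfo v -> w != root -> par w = v ->
     ~~ isInfo w && [exists u, (u != root) && (par u == w)];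
  info_branch : forall v, isInfo v ->
     (1 < #|[pred w | (w != root) && (par w == v)]|)%N;
  act_children : forall a w, ~~ isInfo a ->
     [exists u, (u != root) && (par u == a)] ->
     w != root -> par w = a ->
     isInfo w || ~~ [exists u, (u != root) && (par u == w)]
}.

Section GT.
Variable G : gameTree.
Local Notation node := (node G).

Definition child (w v : node) : bool := (w != root G) && (par w == v).
Definition isLeaf (v : node) : bool := [forall w, ~~ child w v].
Definition isAct (v : node) : bool := ~~ isInfo v && ~~ isLeaf v.

Definition Aset : {set node} := [set a | isAct a].

(* n and m, defined recursively from the bottom (fuel = #|V| exceeds the height) *)
Fixpoint nF (k : nat) (v : node) : nat :=
  match k with
  | 0 => 1
  | k'.+1 => if isInfo v then (\sum_(w | child w v) nF k' w)%N
             else (\prod_(w | child w v && isInfo w) nF k' w)%N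
  end.
Definition nfun (v : node) : nat := nF #|node| v.

Fixpoint mF (k : nat) (v : node) : nat :=
  match k with
  | 0 => 1
  | k'.+1 => if isInfo v then (\sum_(w | child w v) mF k' w)%N
             else (1 + \sum_(w | child w v && isInfo w) mF k' w)%N
  end.
Definition mfun (v : node) : nat := mF #|node| v.

Section Real.
Variable R : realType.

Fixpoint betaF (k : nat) (v : node) : R :=
  match k with
  | 0 => 1
  | k'.+1 => if v == root G then 1
             else if isInfo v then betaF k' (par v) / (mfun v)%:R
             else (mfun v)%:R * betaF k' (par v)
  end.
Definition beta (v : node) : R := betaF #|node| v.

Definition isPure (s : {ffun node -> node}) : bool :=
  [forall v, isInfo v ==> child (s v) v].
Definition isEnv (mu : {ffun node -> node}) : bool :=
  [forall a, isAct a ==> child (mu a) a].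

(* (possibly partial) strategies are represented as node -> option node;
   X is closed for s when it contains r, s v for infosets v in X (where
   defined) and all children of actions in X *)
Definition closedS (s : {ffun node -> option node}) (X : {set node}) : bool :=
  (root G \in X) &&
  [forall v in X,
     (isInfo v ==> (if s v is Some w then w \in X else true)) &&
     (isAct v ==> [forall w, child w v ==> (w \in X)])].
Definition Vset (s : {ffun node -> option node}) : {set node} :=
  [set v | [forall X : {set node}, closedS s X ==> (v \in X)]].
Definition Nset s : {set node} := [set v in Vset s | isInfo v].
Definition Aσ s : {set node} := [set v in Vset s | isAct v].

Definition liftPure (s : {ffun node -> node}) : {ffun node -> option node} :=
  [ffun v => Some (s v)].
Definition reduce (s : {ffun node -> node}) : {ffun node -> option node} :=
  [ffun v => if (v \in Vset (liftPure s)) && isInfo v then Some (s v) else None].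
Definition Sset : {set {ffun node -> option node}} :=
  [set reduce s | s in [pred s | isPure s]].

Fixpoint walk (s : {ffun node -> option node}) (mu : {ffun node -> node})
    (k : nat) (v z : node) : node * node :=
  match k with
  | 0 => (v, z)
  | k'.+1 => if isLeaf v then (v, z)
             else if isInfo v then walk s mu k' (odflt v (s v)) z
             else walk s mu k' (mu v) v
  end.
Definition play s mu : node * node := walk s mu #|node| (root G) (root G).

Variable lam : node -> R.
Definition Loss s mu : R := lam (play s mu).1.
Definition lastAct s mu : node := (play s mu).2.

Variables (T : nat) (eps : R).

Definition etaP : R :=
  (Num.sqrt ((6 * ln T%:R / eps + 9 * (expR 1 - 2) / eps ^+ 2)
              * (mfun (root G))%:R * T%:R / ln (nfun (root G))%:R))^-1.
Definition gammaP : R := 6 * ln T%:R * etaP / eps.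

Definition Qlap (x : R) : R := eps / 4 * expR (- (eps / 2) * `|x|).

Definition pi1 (a : node) : R := (nfun a)%:R / (nfun (par a))%:R.

(* probability that the recursive sampling from policy pi outputs the
   reduced strategy s: product of the independent draws at visited infosets *)
Definition sampleProb (pi : node -> R) (s : {ffun node -> option node}) : R :=
  \prod_(v in Nset s) pi (odflt v (s v)).

(* Update_t(v, x): returns psi_t(v) together with the new policy values
   pi_{t+1}(a) for the actions a below v whose value it sets *)
Fixpoint upd (pi : node -> R) (s : {ffun node -> option node}) (d : node -> R)
    (k : nat) (v : node) (x : R) : R * (node -> option R) :=
  match k with
  | 0 => (1, fun _ => None)
  | k'.+1 =>
    let b := odflt v (s v) in
    let res := [seq (w, upd pi s d k' w (pi b * x))
               | w <- enum node & child w b && isInfo w] in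
    let omega := expR (- (etaP * d b) / (gammaP * beta b + pi b * x))
                 * \prod_(p <- res) p.2.1 in
    let psi := 1 - (1 - omega) * pi b in
    (psi, fun a => if child a v then
                     Some ((if a == b then omega * pi a else pi a) / psi)
                   else foldr (fun p acc => if p.2.2 a is Some y then Some y
                                            else acc) None res)
  end.

Definition newPolicy pi s d : node -> R :=
  fun a => odflt (pi a) ((upd pi s d #|node| (root G) 1).2 a).

Fixpoint noiseInt (l : seq node) (F : (node -> R) -> \bar R) (phi : node -> R)
    : \bar R :=
  match l with
  | [::] => F phi
  | a :: l' => (\int[@lebesgue_measure R]_y
                 ((Qlap y)%:E * noiseInt l' F (fun c => if c == a then y else phi c)))%E
  end.

Variable mu : nat -> {ffun node -> node}.

(* expected sum of the losses of trials t, ..., t + j - 1 when the policy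
   at the start of trial t is pi *)
Fixpoint expLossF (j t : nat) (pi : node -> R) : \bar R :=
  match j with
  | 0 => 0%E
  | j'.+1 =>
    (\sum_(s in Sset)
       (sampleProb pi s)%:E *
       ((Loss s (mu t))%:E +
        noiseInt (enum (Aσ s))
          (fun phi =>
             let d := fun a => ((if a == lastAct s (mu t) then Loss s (mu t) else 0%R)
                               + phi a)%R in
             expLossF j' t.+1 (newPolicy pi s d))
          (fun _ => 0%R)))%E
  end.

Definition expLoss : \bar R := expLossF T 1 pi1.

Definition minLoss : \bar R :=
  \big[Order.min/+oo%E]_(s in Sset) (\sum_(1 <= t < T.+1) Loss s (mu t))%:E.

End Real.
End GT.

(* Main.v *)
Require Import Defs.
From HB Require Import structures.
From mathcomp Require Import all_boot all_order all_algebra.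
From mathcomp Require Import all_classical all_reals all_analysis.
From mathcomp Require Import measurable_realfun zify ring lra.
Import Order.TTheory GRing.Theory Num.Theory.
Import numFieldNormedType.Exports.
(* [root] and [mfun] are also names of MathComp; from here on they are those of [Defs]. *)
Import Defs.
Set Implicit Arguments. Unset Strict Implicit. Unset Printing Implicit Defensive.
Local Open Scope ring_scope.

(** The algorithm is exponential weights over the reduced strategies: [sampleProb pi]
    is a product measure, and one update multiplies the weight of each strategy [t] by
    [exp (- eta * c t)], where [c t] sums over the actions of [t] the estimates
    [d a / (gamma * beta a + q a)] of the sampled actions, [q a] being the probability
    of sampling [a]; the normalising constant is the value returned by the update.

    The potential [- ln (sampleProb pi s) / eta] of a comparator [s] starts at
    [ln n(r) / eta = ln |S| / eta].  Since the inverses of [beta] sum to [1] along every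
    strategy, [eta * c t >= -1] as long as all noises are at least
    [- gamma / eta = - 6 ln T / eps], and then [exp y <= 1 + y + (e - 2) y^2] for [y <= 1]
    bounds the change of potential by a quadratic polynomial in the noises.  Integrated
    over the symmetric event that all noises are at most [6 ln T / eps] in absolute
    value, its linear terms vanish, which leaves: minus the expected loss, up to a bias
    [gamma * |A|] because the [beta a] over the possible last actions sum to
    [m(r) = |A|]; the loss of the comparator; and a variance term
    [(e - 2) * eta * |A| * (1 + 8) / eps^2].  The complementary event has probability at
    most [|A| / T^3] in each trial, so it costs at most [|A| / T <= 1] in total.  If
    [|A| > T] the bound exceeds [T] and is trivial. *)

(** * Game trees and reduced strategies *)

Section Tree.
Variable G : gameTree.
Implicit Types (u v w a b : node G) (s : {ffun node G -> option (node G)}).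
Local Notation r := (root G).

Lemma childP w v : reflect (w != r /\ par w = v) (child w v).
Proof. by apply: (iffP andP) => -[? /eqP]. Qed.

Lemma child_par w : w != r -> child w (par w).
Proof. by move=> wr; apply/childP. Qed.

Lemma childN_leaf w v : child w v -> ~~ isLeaf v.
Proof. by move=> wv; apply/negP => /forallP /(_ w); rewrite wv. Qed.

Lemma child_eq_par w v v' : child w v -> child w v' -> v = v'.
Proof. by move=> /childP [_ <-] /childP [_ <-]. Qed.

Lemma fconnect_root v : fconnect (@par G) v r.
Proof. by have [k <-] := reach_root v; exact: fconnect_iter. Qed.

(** The number of applications of [par] that first reach the root. It stays below [#|node G|], which
    is why that fuel suffices in all the recursive definitions. *)
Definition depth v : nat := findex (@par G) v r.

Lemma depth_child w v : child w v -> depth w = (depth v).+1.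
Proof.
move=> /childP [wr <-]; rewrite /depth.
by rewrite fconnect_findex // ?fconnect_root // eq_sym.
Qed.

Lemma depth_lt v : (depth v < #|node G|)%N.
Proof. by apply: leq_trans (findex_max (fconnect_root v)) (max_card _). Qed.

Lemma node_ind (P : node G -> Prop) :
  P r -> (forall w v, child w v -> P v -> P w) -> forall v, P v.
Proof.
move=> Pr Pc v; have [n] := ubnP (depth v).
elim: n v => // n IH v; have [-> //|vr] := eqVneq v r.
have vc := child_par vr; rewrite (depth_child vc) ltnS => h.
exact: Pc vc (IH _ h).
Qed.

Lemma info_act v : isInfo v -> ~~ isAct v.
Proof. by move=> iv; rewrite /isAct iv. Qed.

Lemma act_info a : isAct a -> ~~ isInfo a.
Proof. by case/andP. Qed.

Lemma act_leaf a : isAct a -> ~~ isLeaf a.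
Proof. by case/andP. Qed.

Lemma child_info_act a v : isInfo v -> child a v -> isAct a.
Proof.
move=> iv /childP [ar pa]; have /andP [na /existsP [u hu]] := info_children iv ar pa.
by rewrite /isAct na /=; apply: (@childN_leaf u).
Qed.

Lemma info_leaf v : isInfo v -> ~~ isLeaf v.
Proof.
move=> iv; have /card_gt0P [w hw] : (0 < #|[pred w | child w v]|)%N.
  by apply: leq_trans (info_branch iv).
exact: childN_leaf hw.
Qed.

Lemma leafP v : isLeaf v -> ~~ isInfo v /\ ~~ isAct v.
Proof.
move=> lv; split; first by apply: contraL lv; exact: info_leaf.
by rewrite /isAct lv andbF.
Qed.

Lemma child_act w a : isAct a -> child w a -> isInfo w || isLeaf w.
Proof.
move=> /andP [na la] cw; have /childP [wr pw] := cw.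
have ex : [exists u, (u != r) && (par u == a)].
  by apply/existsP; exists w; exact: cw.
case/orP: (act_children na ex wr pw) => [->//|h].
apply/orP; right; apply/forallP => u.
by move: h; rewrite negb_exists => /forallP /(_ u).
Qed.

Lemma act_root a : isAct a -> a != r.
Proof. by apply: contraTneq => ->; apply: info_act; exact: info_root. Qed.

Lemma node_kind v : [|| isInfo v, isAct v | isLeaf v].
Proof. by rewrite /isAct; case: (isInfo v); case: (isLeaf v). Qed.

Lemma par_act a : isAct a -> isInfo (par a).
Proof.
move=> ia; have ca := child_par (act_root ia).
case/or3P: (node_kind (par a)) => // [pa|]; last by rewrite (negPf (childN_leaf ca)).
case/orP: (child_act pa ca); first by rewrite (negPf (act_info ia)).
by rewrite (negPf (act_leaf ia)).
Qed.

Lemma par_info v : v != r -> isInfo v -> isAct (par v).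
Proof.
move=> vr iv; have cv := child_par vr.
case/or3P: (node_kind (par v)) => // [pv|]; last by rewrite (negPf (childN_leaf cv)).
by have := child_info_act pv cv; rewrite (negPf (info_act iv)).
Qed.

Lemma child_neq_root w v : child w v -> w != r.
Proof. by case/childP. Qed.

Section Telescope.
Context {A : Type} {idx : A} {op : Monoid.com_law idx}.

(* Every node of [X] but the root is counted once, under its parent. *)
Lemma telescope (X : {set node G}) (h : node G -> A) :
  r \in X -> (forall w, w \in X -> w != r -> par w \in X) ->
  \big[op/idx]_(u in X) h u =
  op (h r) (\big[op/idx]_(u in X) \big[op/idx]_(w | child w u && (w \in X)) h w).
Proof.
move=> rX pX; rewrite (bigD1 r) //=; congr (op _ _).
rewrite (partition_big (@par G) (mem X)) /=; last first.
  by move=> w /andP [wX wr]; exact: pX.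
apply: eq_bigr => u uX; apply: eq_bigl => w.
by rewrite /child -andbA andbC.
Qed.

End Telescope.

(** The same default as in [sampleProb], [walk] and [upd]; for a reduced strategy it never occurs at
    a visited infoset. *)
Definition act s v := odflt v (s v).

Lemma closedP s (X : {set node G}) :
  reflect [/\ r \in X,
     forall v w, v \in X -> isInfo v -> s v = Some w -> w \in X &
     forall v w, v \in X -> isAct v -> child w v -> w \in X] (closedS s X).
Proof.
apply: (iffP andP) => [[rX /forallP h]|[rX h1 h2]]; split => //.
- move=> v w vX iv sv; move/implyP: (h v) => /(_ vX) /andP [/implyP /(_ iv)].
  by rewrite sv.
- move=> v w vX iv cw; move/implyP: (h v) => /(_ vX) /andP [_ /implyP /(_ iv)].
  by move=> /forallP /(_ w); rewrite cw.
- apply/forallP => v; apply/implyP => vX; apply/andP; split; apply/implyP => iv.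
    by case sv: (s v) => [w|//]; exact: h1 sv.
  by apply/forallP => w; apply/implyP => cw; exact: h2 cw.
Qed.

Lemma Vset_min s X : closedS s X -> Vset s \subset X.
Proof.
move=> cX; apply/fintype.subsetP => v; rewrite inE => /forallP /(_ X).
by rewrite cX.
Qed.

Lemma Vset_closed s : closedS s (Vset s).
Proof.
have sub X v : closedS s X -> v \in Vset s -> v \in X.
  by move=> cX; apply: (fintype.subsetP (Vset_min cX)).
apply/closedP; split => [|v w vX iv sv|v w vX iv cw]; rewrite inE;
  apply/forallP => X; apply/implyP => cX; have /closedP [rX h1 h2] := cX => //.
- exact: h1 (sub _ _ cX vX) iv sv.
- exact: h2 (sub _ _ cX vX) iv cw.
Qed.

Lemma root_Vset s : r \in Vset s.
Proof. by have /closedP [] := Vset_closed s. Qed.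

Lemma Vset_act s w a : a \in Vset s -> isAct a -> child w a -> w \in Vset s.
Proof. by have /closedP [_ _] := Vset_closed s; apply. Qed.

Lemma Vset_agree_sub s1 s2 :
  (forall v, v \in Vset s1 -> isInfo v -> s2 v = s1 v) -> Vset s2 \subset Vset s1.
Proof.
move=> h; apply: Vset_min; have /closedP [rX h1 h2] := Vset_closed s1.
by apply/closedP; split => // v w vX iv; rewrite h //; exact: h1.
Qed.

(** Agreement on the nodes visited by [s1] gives one inclusion, hence agreement on the nodes visited
    by [s2], hence the other inclusion. *)
Lemma Vset_agree s1 s2 :
  (forall v, v \in Vset s1 -> isInfo v -> s2 v = s1 v) -> Vset s2 = Vset s1.
Proof.
move=> h; apply/eqP; rewrite finset.eqEsubset Vset_agree_sub //=.
apply: Vset_agree_sub => v v2 iv; rewrite h //.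
by apply: (fintype.subsetP (Vset_agree_sub h)).
Qed.

Lemma Vset_reduce p : Vset (reduce p) = Vset (@liftPure G p).
Proof. by apply: Vset_agree => v vV iv; rewrite !ffunE vV iv. Qed.

Lemma SsetP s : reflect (exists2 p, isPure p & s = reduce p) (s \in Sset G).
Proof.
by apply: (iffP imsetP) => -[p hp ->]; exists p => //; rewrite inE in hp *.
Qed.

Lemma pureP (p : {ffun node G -> node G}) :
  reflect (forall v, isInfo v -> child (p v) v) (isPure p).
Proof.
apply: (iffP forallP) => h v; last by apply/implyP; exact: h.
by move=> iv; move/implyP: (h v); apply.
Qed.

(** * Visited nodes of a reduced strategy *)

Section Strategy.
Variables (s : {ffun node G -> option (node G)}) (sS : s \in Sset G).

Lemma strat_Some v : v \in Vset s -> isInfo v -> s v = Some (act s v).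
Proof.
have /SsetP [p /pureP hp ->] := sS => vV iv.
by rewrite /act ffunE -Vset_reduce vV iv.
Qed.

Lemma strat_child v : v \in Vset s -> isInfo v -> child (act s v) v.
Proof.
have /SsetP [p /pureP hp ->] := sS => vV iv.
by rewrite /act ffunE -Vset_reduce vV iv /=; exact: hp.
Qed.

Lemma strat_in v : v \in Vset s -> isInfo v -> act s v \in Vset s.
Proof.
move=> vV iv; have /closedP [_ h _] := Vset_closed s.
exact: h (strat_Some vV iv).
Qed.

Lemma strat_act v : v \in Vset s -> isInfo v -> isAct (act s v).
Proof. by move=> vV iv; apply: child_info_act iv (strat_child vV iv). Qed.

(** Inversion of the least closed set: the root and the visited nodes that satisfy the conclusion
    form a closed set, so it contains all visited nodes. *)
Lemma Vset_par_strong w : w \in Vset s -> w != r ->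
  (par w \in Vset s) && (isInfo (par w) ==> (act s (par w) == w)).
Proof.
pose X := [set v in Vset s | (v == r) ||
  ((par v \in Vset s) && (isInfo (par v) ==> (act s (par v) == v)))].
have sub : Vset s \subset X.
  apply: Vset_min; apply/closedP; split => [|v w0|v w0].
  - by rewrite inE root_Vset eqxx.
  - rewrite inE => /andP [vV _] iv sv.
    have -> : w0 = act s v by rewrite /act sv.
    rewrite inE strat_in //=; have /childP [_ ->] := strat_child vV iv.
    by rewrite vV eqxx implybT orbT.
  - rewrite inE => /andP [vV _] iv cw; rewrite inE (Vset_act vV iv cw) /=.
    by have /childP [_ ->] := cw; rewrite vV (negPf (act_info iv)) orbT.
move=> wV wr; have := fintype.subsetP sub _ wV.
by rewrite inE wV (negPf wr).
Qed.

Lemma Vset_par w : w \in Vset s -> w != r -> par w \in Vset s.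
Proof. by move=> wV wr; case/andP: (Vset_par_strong wV wr). Qed.

Lemma Vset_child w v : child w v -> w \in Vset s -> v \in Vset s.
Proof. by move=> /childP [wr <-] wV; exact: Vset_par. Qed.

Lemma Vset_child_info w v : v \in Vset s -> isInfo v -> child w v ->
  (w \in Vset s) = (w == act s v).
Proof.
move=> vV iv /childP [wr pw]; apply/idP/eqP => [wV|->]; last exact: strat_in.
have /andP [_] := Vset_par_strong wV wr.
by rewrite pw iv => /eqP.
Qed.

Lemma child_Vset_info w v : v \in Vset s -> isInfo v ->
  child w v && (w \in Vset s) = (w == act s v).
Proof.
move=> vV iv; apply/andP/eqP => [[cw]|->].
  by rewrite (Vset_child_info vV iv cw) => /eqP.
by rewrite strat_child // strat_in.
Qed.

Lemma child_Vset_act w a : a \in Vset s -> isAct a ->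
  child w a && (w \in Vset s) = child w a.
Proof.
by move=> aV ia; case cw: (child w a) => //=; exact: Vset_act cw.
Qed.

Lemma in_Nset v : (v \in Nset s) = (v \in Vset s) && isInfo v.
Proof. by rewrite inE. Qed.

Lemma in_Aset_strat v : (v \in Aσ s) = (v \in Vset s) && isAct v.
Proof. by rewrite inE. Qed.

Section BigStrat.
Context {A : Type} {idx : A} {op : Monoid.com_law idx}.

(** [act s] is a bijection from the visited infosets to the visited actions, with inverse [par]. *)
Lemma big_act (F : node G -> A) :
  \big[op/idx]_(v in Nset s) F (act s v) = \big[op/idx]_(a in Aσ s) F a.
Proof.
rewrite [RHS](partition_big (@par G) (mem (Nset s))) /=; last first.
  move=> a; rewrite in_Aset_strat in_Nset => /andP [aV ia].
  by rewrite Vset_par ?act_root // par_act.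
apply: eq_bigr => v; rewrite in_Nset => /andP [vV iv].
rewrite (big_pred1 (act s v)) // => a /=.
rewrite in_Aset_strat -(child_Vset_info a vV iv).
apply/andP/andP => [[/andP [aV ia] /eqP <-]|[ca aV]].
  by rewrite aV child_par // act_root.
by have /childP [_ ->] := ca; rewrite aV (child_info_act iv ca).
Qed.

Lemma big_Vset (F : node G -> A) : (forall u, isLeaf u -> F u = idx) ->
  \big[op/idx]_(v in Vset s) F v =
  op (\big[op/idx]_(v in Nset s) F v) (\big[op/idx]_(a in Aσ s) F a).
Proof.
move=> Fl; rewrite (bigID (@isInfo G)) /=; congr (op _ _).
  by apply: eq_bigl => v; rewrite in_Nset.
rewrite (bigID (@isAct G)) /= [X in op _ X]big1 ?Monoid.mulm1; last first.
  move=> v /andP [/andP [_ iv] av]; apply: Fl.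
  by case/or3P: (node_kind v) => //; [rewrite (negPf iv)|rewrite (negPf av)].
apply: eq_bigl => v; rewrite in_Aset_strat -andbA; congr (_ && _).
by rewrite /isAct; case: (isInfo v).
Qed.

(* Both sides carry the weights of the actions, which are not cancellable in a monoid. *)
Lemma telescope_strat (Z : node G -> A) :
  let K a := \big[op/idx]_(w | child w a && isInfo w) Z w in
  op (\big[op/idx]_(v in Nset s) Z v) (\big[op/idx]_(a in Aσ s) K a) =
  op (Z r) (op (\big[op/idx]_(a in Aσ s) K a) (\big[op/idx]_(a in Aσ s) K a)).
Proof.
(* Telescoping [h] yields [K] twice: a visited action is counted under the infoset that chooses it,
   and its infoset children are counted under the action. *)
move=> K; pose h u := if isInfo u then Z u else K u.
have hN v : v \in Nset s -> h v = Z v by rewrite in_Nset /h => /andP [_ ->].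
have hA a : a \in Aσ s -> h a = K a.
  by rewrite in_Aset_strat /h => /andP [_ /act_info/negPf ->].
have hl u : isLeaf u -> h u = idx.
  move=> lu; have [/negPf nu _] := leafP lu; rewrite /h nu /K big_pred0 // => w.
  by rewrite (negPf (contraL (@childN_leaf w u) lu)).
have := telescope (op := op) h (root_Vset s) Vset_par.
rewrite (big_Vset hl) (eq_bigr _ hN) (eq_bigr _ hA) => ->.
rewrite {1}/h info_root; congr (op _ _).
pose h2 u := \big[op/idx]_(w | child w u && (w \in Vset s)) h w.
rewrite -/(h2 _) (@big_Vset h2) => [|u lu]; last first.
  by rewrite /h2 big_pred0 // => w; rewrite (negPf (contraL (@childN_leaf w u) lu)).
congr (op _ _).
  rewrite -[RHS]big_act; apply: eq_bigr => v vN.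
  have := vN; rewrite in_Nset => /andP [vV iv].
  rewrite /h2 (eq_bigl (pred1 (act s v))) => [|w]; last exact: child_Vset_info.
  by rewrite big_pred1_eq hA // in_Aset_strat strat_in // strat_act.
apply: eq_bigr => a; rewrite in_Aset_strat => /andP [aV ia].
rewrite /h2 (eq_bigl (fun w => child w a)) => [|w]; last exact: child_Vset_act.
rewrite (bigID (@isInfo G)) /= [X in op _ X]big1 ?Monoid.mulm1.
  by apply: eq_bigr => w /andP [_ iw]; rewrite /h iw.
move=> w /andP [cw niw]; apply: hl.
by have := child_act ia cw; rewrite (negPf niw).
Qed.

End BigStrat.

End Strategy.

Lemma reduce_eq s (p : {ffun node G -> node G}) : s \in Sset G -> isPure p ->
  (reduce p == s) = [forall v in Nset s, p v == act s v].
Proof.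
move=> sS hp; apply/eqP/forallP => [<- v|h].
  apply/implyP; rewrite in_Nset Vset_reduce => /andP [vV iv].
  by rewrite /act ffunE vV iv.
have {}h v : v \in Vset s -> isInfo v -> p v = act s v.
  by move=> vV iv; apply/eqP; move/implyP: (h v); apply; rewrite in_Nset vV.
have VE : Vset (liftPure p) = Vset s.
  by apply: Vset_agree => v vV iv; rewrite ffunE (strat_Some sS) // h.
apply/ffunP => v; rewrite ffunE VE; case: ifPn => [/andP [vV iv]|].
  by rewrite (strat_Some sS) // h.
have /SsetP [p0 _ sE] := sS.
by rewrite sE ffunE Vset_reduce => /negPf ->.
Qed.

(** * Total mass of the sampling distribution *)

Section Probability.
Variable R : realType.
Implicit Type pi : node G -> R.

Definition normalized pi := forall v, isInfo v -> \sum_(a | child a v) pi a = 1.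

Lemma sampleProbE pi s : s \in Sset G -> sampleProb pi s = \prod_(a in Aσ s) pi a.
Proof. by move=> sS; rewrite -(big_act sS). Qed.

(* Extending a reduced strategy by independent draws at the unvisited infosets
   turns the sum into the expansion of [\prod_v \sum_a pi a] over pure strategies. *)
Lemma sum_sampleProb pi : normalized pi -> \sum_(s in Sset G) sampleProb pi s = 1.
Proof.
move=> npi.
have famP (p : {ffun node G -> node G}) (Q : node G -> pred (node G)) :
    (forall v, isInfo v -> {subset Q v <= [pred w | child w v]}) ->
    p \in pfamily r (@isInfo G) Q -> isPure p.
  move=> hQ /pfamilyP [_ h]; apply/pureP => v iv; apply: (hQ v iv).
  exact: (h v iv).
transitivity (\prod_(v | isInfo v) \sum_(a | child a v) pi a); last first.
  by rewrite big1.
rewrite (big_distr_big_dep r) /=.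
rewrite [RHS](partition_big (@reduce G) (mem (Sset G))) /=; last first.
  move=> p hp; apply/SsetP; exists p => //.
  exact: (famP _ _ (fun v iv a h => h) hp).
apply: eq_bigr => s sS.
(* [Q] describes the pure strategies that reduce to [s]: the choice is fixed at visited infosets and
   free at the others, whose factors then sum to [1]. *)
pose Q v : pred (node G) := if v \in Nset s then pred1 (act s v) else [pred w | child w v].
have QN v : isInfo v -> {subset Q v <= [pred w | child w v]}.
  move=> iv a; rewrite /Q; case: ifPn => [|_ //]; rewrite in_Nset iv andbT => vV.
  by rewrite !inE => /eqP ->; exact: strat_child.
rewrite (eq_bigl (fun p => p \in pfamily r (@isInfo G) Q)); last first.
  move=> p; apply/andP/idP => [[pf]|pf].
    have pp : isPure p by exact: (famP _ _ (fun v iv a h => h) pf).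
    rewrite reduce_eq // => /forallP h; move/pfamilyP: pf => [p1 p2].
    apply/pfamilyP; split => // v iv; rewrite /Q.
    case: ifPn => [vN|_]; last exact: (p2 v iv).
    by rewrite inE; have /implyP /(_ vN) := h v.
  have pp := famP p Q QN pf; move/pfamilyP: pf => [p1 p2]; split.
    by apply/pfamilyP; split => // v iv; apply: (QN v iv); exact: p2.
  rewrite reduce_eq //; apply/forallP => v; apply/implyP => vN.
  have iv : isInfo v by move: vN; rewrite in_Nset => /andP [].
  by have := p2 v iv; rewrite /Q vN inE.
rewrite -(big_distr_big_dep r (@isInfo G) Q (fun _ => pi)) /=.
rewrite (bigID (mem (Nset s))) /= [X in _ * X]big1 ?mulr1.
  apply: eq_big => [v|v vN]; first by rewrite in_Nset; case: isInfo; rewrite ?andbF ?andbT.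
  by rewrite /Q vN big_pred1_eq.
by move=> v /andP [iv /negPf vN]; rewrite /Q vN npi.
Qed.

End Probability.
End Tree.

(** * Recursive functions, plays and sampling probabilities *)

Section Recursions.
Variable G : gameTree.
Implicit Types (u v w a b x y : node G) (s : {ffun node G -> option (node G)}).
Local Notation r := (root G).
Local Notation D := #|node G|.
(** [anc u x] says that [x] lies on the path from the root to [u], both ends included. *)
Local Notation anc := (fconnect (@par G)).

Lemma node_ind_bottom (P : node G -> Prop) :
  (forall v, (forall w, child w v -> P w) -> P v) -> forall v, P v.
Proof.
move=> Pc v; have [n] := ubnP (D - depth v).
elim: n v => // n IH v h; apply: Pc => w cw; apply: IH.
by have := depth_lt w; have := depth_child cw; lia.
Qed.

(** The subtree of [v] has at most [D - depth v] levels, so any larger fuel gives the same value,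
    and the recursive equation [nfunE] follows. *)
Lemma nF_stable k k' v : (D - depth v <= k)%N -> (D - depth v <= k')%N ->
  nF k v = nF k' v.
Proof.
elim: k k' v => [|k IH] [|k'] v h h'; have := depth_lt v => dv; try lia.
have cs w : child w v -> nF k w = nF k' w.
  by move=> cw; apply: IH; rewrite (depth_child cw); lia.
by rewrite /=; case: ifP => _; apply: eq_bigr => w; [move=> /cs|case/andP => /cs].
Qed.

Lemma nfunE v : nfun v =
  (if isInfo v then \sum_(w | child w v) nfun w
   else \prod_(w | child w v && isInfo w) nfun w)%N.
Proof.
rewrite {1}/nfun (@nF_stable D D.+1) /=; try lia.
by case: ifP.
Qed.

Lemma mF_stable k k' v : (D - depth v <= k)%N -> (D - depth v <= k')%N ->
  mF k v = mF k' v.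
Proof.
elim: k k' v => [|k IH] [|k'] v h h'; have := depth_lt v => dv; try lia.
have cs w : child w v -> mF k w = mF k' w.
  by move=> cw; apply: IH; rewrite (depth_child cw); lia.
rewrite /=; case: ifP => _; [|congr addn]; apply: eq_bigr => w; first by move=> /cs.
by case/andP => /cs.
Qed.

Lemma mfunE v : mfun v =
  (if isInfo v then \sum_(w | child w v) mfun w
   else 1 + \sum_(w | child w v && isInfo w) mfun w)%N.
Proof.
rewrite {1}/mfun (@mF_stable D D.+1) /=; try lia.
by case: ifP.
Qed.

Lemma info_childE v : isInfo v -> exists w, child w v.
Proof.
move=> iv; have /card_gt0P [w hw] : (0 < #|[pred w | child w v]|)%N.
  by apply: leq_trans (info_branch iv).
by exists w.
Qed.

Lemma nfun_gt0 v : (0 < nfun v)%N.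
Proof.
elim/node_ind_bottom: v => v IH; rewrite nfunE; case: ifPn => iv.
  have [w cw] := info_childE iv.
  by rewrite (bigD1 w) //= ltn_addr // IH.
by apply: prodn_cond_gt0 => w /andP [/IH].
Qed.

Lemma mfun_gt0 v : (0 < mfun v)%N.
Proof.
elim/node_ind_bottom: v => v IH; rewrite mfunE; case: ifPn => iv //.
have [w cw] := info_childE iv.
by rewrite (bigD1 w) //= ltn_addr // IH.
Qed.

Lemma nfun_root_gt1 : (1 < nfun r)%N.
Proof.
rewrite nfunE info_root; apply: leq_trans (info_branch (info_root G)) _.
rewrite -sum1_card; apply: leq_sum => w _; exact: nfun_gt0.
Qed.

(** Count every node under its parent, weighted by [m]: both sides of the recursion of [m] cancel
    except for the summand [1] of each action. *)
Lemma mfun_root : mfun r = #|Aset G|.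
Proof.
(* [mfun] equals [1] on leaves, which must not be counted. *)
pose h u := if isLeaf u then 0%N else mfun u.
have := telescope (op := addn) (X := [set: node G]) h.
rewrite finset.in_setT => /(_ isT (fun w _ _ => finset.in_setT _)).
have -> : h r = mfun r by rewrite /h (negPf (info_leaf (info_root G))).
suff -> : (\sum_(u in [set: node G]) h u =
  #|Aset G| + \sum_(u in [set: node G]) \sum_(w | child w u && (w \in [set: node G])) h w)%N.
  by move/eqP; rewrite eqn_add2r => /eqP.
have -> : #|Aset G| = (\sum_(u in [set: node G]) isAct u)%N.
  rewrite -sum1_card big_mkcond [RHS]big_mkcond; apply: eq_bigr => u _.
  by rewrite finset.in_setT inE; case: isAct.
rewrite -big_split; apply: eq_bigr => u _ /=.
under [X in (_ + X)%N]eq_bigl do rewrite finset.in_setT andbT.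
rewrite /h; case/or3P: (node_kind u) => iu.
- rewrite (negPf (info_leaf iu)) (negPf (info_act iu)) mfunE iu add0n.
  apply: eq_bigr => w cw.
  by rewrite (negPf (act_leaf (child_info_act iu cw))).
- rewrite (negPf (act_leaf iu)) iu mfunE (negPf (act_info iu)); congr addn.
  rewrite [RHS](bigID (@isInfo G)) /= [X in (_ + X)%N]big1 ?addn0.
    by apply: eq_bigr => w /andP [_ iw]; rewrite (negPf (info_leaf iw)).
  move=> w /andP [cw niw]; have := child_act iu cw.
  by rewrite (negPf niw) /= => ->.
- rewrite iu /isAct iu andbF big_pred0 // => w.
  by apply/negbTE; apply: contraL iu; exact: childN_leaf.
Qed.

Lemma anc_refl x : anc x x. Proof. exact: connect0. Qed.

Lemma anc_child w v x : child w v -> anc w x = (x == w) || anc v x.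
Proof.
move=> /childP [_ <-]; apply/idP/orP => [/iter_findex|[/eqP ->|]].
- case: findex => [<-|n <-]; first by left.
  by right; rewrite iterSr fconnect_iter.
- exact: connect0.
- exact: connect_trans (fconnect1 _ _).
Qed.

Lemma anc_root x : anc r x = (x == r).
Proof.
apply/idP/eqP => [/iter_findex <-|->]; last exact: connect0.
by elim: findex => //= n ->; exact: par_root.
Qed.

Lemma anc_depth u x : anc u x -> (depth x <= depth u)%N.
Proof.
elim/node_ind: u => [|w v cw IH]; first by rewrite anc_root => /eqP ->.
rewrite (anc_child _ cw) => /orP [/eqP -> //|/IH h].
by rewrite (depth_child cw) ltnW.
Qed.

Lemma anc_depth_inj u x y : anc u x -> anc u y -> depth x = depth y -> x = y.
Proof.
elim/node_ind: u => [|w v cw IH]; first by rewrite !anc_root => /eqP -> /eqP ->.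
rewrite !(anc_child _ cw) => /orP [/eqP ->|hx] /orP [/eqP ->|hy] //; last exact: IH.
- by move=> h; have := anc_depth hy; have := depth_child cw; lia.
- by move=> h; have := anc_depth hx; have := depth_child cw; lia.
Qed.

Lemma anc_par u w v : child w v -> anc u w -> anc u v.
Proof. by move=> /childP [_ <-] h; apply: connect_trans h (fconnect1 _ _). Qed.

Lemma anc_next u v : anc u v -> u != v -> exists2 w, child w v & anc u w.
Proof.
elim/node_ind: u => [|w0 v0 cw IH]; first by rewrite anc_root => /eqP ->; rewrite eqxx.
rewrite (anc_child _ cw) => /orP [/eqP ->|]; first by rewrite eqxx.
have [<- _ _|vv h _] := eqVneq v0 v; first by exists w0; rewrite ?anc_refl.
have [w cwv aw] := IH h vv; exists w => //.
by rewrite (anc_child _ cw) aw orbT.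
Qed.

Lemma Vset_anc s u x :
  s \in Sset G -> u \in Vset s -> anc u x -> x \in Vset s.
Proof.
move=> sS uV /iter_findex <-; elim: findex => //= n IH.
have [->|nr] := eqVneq (iter n (@par G) u) r; first by rewrite par_root root_Vset.
exact: Vset_par.
Qed.

Section Real.
Variable R : realType.
Local Notation bt := (@beta G R).
Implicit Type pi : node G -> R.

Lemma betaF_stable k k' v : (depth v <= k)%N -> (depth v <= k')%N ->
  betaF R k v = betaF R k' v.
Proof.
have br i : betaF R i r = 1 by case: i => //= i; rewrite eqxx.
elim: k k' v => [|k IH] k' v h h'; have [->|vr] := eqVneq v r; rewrite ?br //.
  by have := depth_child (child_par vr); lia.
case: k' h' => [|k'] h'; have := depth_child (child_par vr) => dv; first by lia.
by rewrite /= (negPf vr) (IH k') //; lia.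
Qed.

Lemma beta_root : bt r = 1.
Proof. by rewrite /beta; case: #|_| => //= i; rewrite eqxx. Qed.

Lemma beta_info w a : child w a -> isInfo w -> bt w = bt a / (mfun w)%:R.
Proof.
move=> cw iw; have dw := ltnW (depth_lt w).
rewrite {1}/beta (@betaF_stable _ D.+1) //= ?leqW //.
by have /childP [/negPf -> ->] := cw; rewrite iw.
Qed.

Lemma beta_act a v : child a v -> isAct a -> bt a = (mfun a)%:R * bt v.
Proof.
move=> cw iw; have dw := ltnW (depth_lt a).
rewrite {1}/beta (@betaF_stable _ D.+1) //= ?leqW //.
by have /childP [/negPf -> ->] := cw; rewrite (negPf (act_info iw)).
Qed.

Lemma beta_gt0 v : isInfo v || isAct v -> 0 < bt v.
Proof.
elim/node_ind: v => [_|w v cw IH /orP [iw|iw]]; first by rewrite beta_root.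
- have /par_info := iw => /(_ (child_neq_root cw)); have /childP [_ ->] := cw => iv.
  by rewrite (beta_info cw iw) divr_gt0 ?ltr0n ?mfun_gt0 // IH // iv orbT.
- have /par_act := iw; have /childP [_ ->] := cw => iv.
  by rewrite (beta_act cw iw) mulr_gt0 ?ltr0n ?mfun_gt0 // IH // iv.
Qed.

(** The inverses of [beta] form a unit flow from the root: if [v] is the parent of [a], then
    [1 / beta v = m(a) / beta a] splits into [1 / beta a], absorbed at [a], and the values
    [1 / beta w] of the infosets [w] below [a]. *)
Lemma sum_inv_beta s : s \in Sset G -> \sum_(a in Aσ s) (bt a)^-1 = 1.
Proof.
move=> sS; have := telescope_strat sS (op := +%R) (fun v => (bt v)^-1).
rewrite beta_root invr1 /= addrA => /addIr.
have -> : \sum_(v in Nset s) (bt v)^-1 = \sum_(a in Aσ s) (bt (par a))^-1.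
  rewrite -(big_act sS); apply: eq_bigr => v; rewrite in_Nset => /andP [vV iv].
  by have /childP [_ ->] := strat_child sS vV iv.
move=> h; apply: (addIr (\sum_(a in Aσ s) \sum_(w | child w a && isInfo w) (bt w)^-1)).
rewrite -h -big_split /=; apply: eq_bigr => a.
rewrite in_Aset_strat => /andP [aV ia].
have b0 : bt a != 0 by rewrite gt_eqF // beta_gt0 // ia orbT.
have m0 : (mfun a)%:R != 0 :> R by rewrite pnatr_eq0 -lt0n mfun_gt0.
have -> : (bt (par a))^-1 = (mfun a)%:R / bt a.
  have ba := beta_act (child_par (act_root ia)) ia.
  rewrite ba invfM mulrA divff // mul1r //.
rewrite {1}mfunE (negPf (act_info ia)) natrD mulrDl mul1r; congr (_ + _).
rewrite natr_sum mulr_suml; apply: eq_bigr => w /andP [cw iw].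
by rewrite (beta_info cw iw) invfM invrK mulrC.
Qed.

(** * Plays against a fixed environment *)

Section Environment.
Variables (mu : {ffun node G -> node G}) (hmu : isEnv mu).

(** The nodes that can be reached against [mu]: infosets leave all choices open, while an action on
    the path must be followed by its response under [mu]. *)
Definition envset : {set node G} :=
  [set u | [forall w, [&& anc u w, w != r & isAct (par w)] ==> (mu (par w) == w)]].

Lemma env_child a : isAct a -> child (mu a) a.
Proof. by move=> ia; move/forallP: hmu => /(_ a) /implyP; apply. Qed.

Lemma root_envset : r \in envset.
Proof.
rewrite inE; apply/forallP => w; apply/implyP.
by rewrite anc_root => /and3P [->].
Qed.

Lemma child_envset w u : child w u ->
  (w \in envset) = (u \in envset) && (isAct u ==> (mu u == w)).
Proof.
move=> cw; have /childP [wr pw] := cw; rewrite !inE; apply/forallP/andP => [h|[/forallP h1 h2] x].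
  split; [apply/forallP => x|apply/implyP => iu].
    apply/implyP => /and3P [h1 h2 h3]; move/implyP: (h x); apply.
    by rewrite (anc_child _ cw) h1 orbT h2.
  by move/implyP: (h w); rewrite pw; apply; rewrite anc_refl wr.
apply/implyP; rewrite (anc_child _ cw) => /and3P [/orP [/eqP -> _|ux xr] ix].
  by move: h2 ix; rewrite pw => /implyP; apply.
by move/implyP: (h1 x); apply; rewrite ux xr.
Qed.

(** The possible last actions against [mu]. *)
Definition cand a := [&& isAct a, a \in envset & isLeaf (mu a)].

Lemma child_envset_act a w : isAct a -> a \in envset ->
  child w a && (w \in envset) = (w == mu a).
Proof.
move=> ia ae; apply/andP/eqP => [[cw]|->].
  by rewrite (child_envset cw) ia => /andP [_ /eqP].
by rewrite (child_envset (env_child ia)) ae ia eqxx env_child.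
Qed.

Lemma envset_par w : w \in envset -> w != r -> par w \in envset.
Proof. by move=> we /child_par cw; move: we; rewrite (child_envset cw) => /andP []. Qed.

(** Dual to [sum_inv_beta]: a flow of mass [m(r)] starts at the root, an infoset [v] splits
    [beta v * m(v)] into the [beta a] of its actions, and an action passes [beta a] on to its
    response unless that is a leaf. *)
Lemma sum_beta_cand : \sum_(a | cand a) bt a = (mfun r)%:R.
Proof.
pose h u := if isInfo u then bt u * (mfun u)%:R else if isAct u then bt u else 0.
have := telescope (op := +%R) h root_envset envset_par.
rewrite {2}/h info_root beta_root mul1r /=.
suff -> : \sum_(u in envset) h u = \sum_(a | cand a) bt a +
    \sum_(u in envset) \sum_(w | child w u && (w \in envset)) h w by move/addIr.
rewrite [X in X + _](_ : _ = \sum_(u in envset) if cand u then bt u else 0); last first.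
  rewrite -big_mkcondr; apply: eq_bigl => u; rewrite /cand.
  by case: (u \in envset); rewrite ?andbF.
rewrite -big_split; apply: eq_bigr => u ue /=.
rewrite /cand ue {1}/h; case/or3P: (node_kind u) => iu.
- rewrite iu (negPf (info_act iu)) add0r.
  rewrite (eq_bigl (fun w => child w u)); last first.
    move=> w; case cw: child => //=.
    by rewrite (child_envset cw) ue (negPf (info_act iu)).
  rewrite mfunE iu natr_sum mulr_sumr; apply: eq_bigr => w cw.
  have iw := child_info_act iu cw.
  by rewrite /h (negPf (act_info iw)) iw (beta_act cw iw) mulrC.
- rewrite iu (negPf (act_info iu)) (big_pred1 (mu u)) => [|w]; last exact: child_envset_act.
  have cm := env_child iu; rewrite /h /=.
  case/orP: (child_act iu cm) => im.
    rewrite im (negPf (info_leaf im)) add0r (beta_info cm im) divfK //.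
    by rewrite pnatr_eq0 -lt0n mfun_gt0.
  by have [/negPf -> /negPf ->] := leafP im; rewrite im addr0.
- have [/negPf -> /negPf ->] := leafP iu; rewrite big_pred0 ?addr0 // => w.
  by rewrite (negPf (contraL (@childN_leaf _ w u) iu)).
Qed.

Section Play.
Variables (s : {ffun node G -> option (node G)}) (sS : s \in Sset G).

Let X := Vset s :&: envset.

(** The walk stays among the nodes allowed by both players. The invariant constrains [z] only at a
    leaf, where it has to be the parent. *)
Lemma walk_leaf k v z : v \in X -> (isLeaf v -> z = par v) ->
  (D - depth v <= k)%N ->
  let: (u, z') := walk s mu k v z in [/\ u \in X, isLeaf u & z' = par u].
Proof.
elim: k v z => [|k IH] v z vX hz h; first by have := depth_lt v; lia.
have := vX; rewrite inE => /andP [vV vM].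
rewrite /=; case: ifPn => [lv|nlv]; first by rewrite hz.
case: ifPn => [iv|niv]; apply: IH.
- by rewrite inE strat_in //= (child_envset (strat_child sS vV iv)) vM (negPf (info_act iv)).
- by rewrite (negPf (act_leaf (strat_act sS vV iv))).
- by rewrite (depth_child (strat_child sS vV iv)); have := depth_lt v; lia.
- have iv : isAct v by rewrite /isAct niv nlv.
  have cm := env_child iv.
  by rewrite inE (Vset_act vV iv cm) (child_envset cm) vM eqxx implybT.
- have iv : isAct v by rewrite /isAct niv nlv.
  by have /childP [_ ->] := env_child iv.
- have iv : isAct v by rewrite /isAct niv nlv.
  by rewrite (depth_child (env_child iv)); have := depth_lt v; lia.
Qed.

(** [X] is a path: each of its nodes other than a leaf has exactly one child in [X]. Counting nodes
    under their parents then leaves exactly one leaf. *)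
Lemma leaf_unique u u' : u \in X -> isLeaf u -> u' \in X -> isLeaf u' -> u = u'.
Proof.
have rX : r \in X by rewrite inE root_Vset root_envset.
have pX w : w \in X -> w != r -> par w \in X.
  by rewrite !finset.in_setI => /andP [wV wM] wr; rewrite (Vset_par sS wV wr) (envset_par wM wr).
have := telescope (op := addn) (fun => 1%N) rX pX.
suff -> : (\sum_(u in X) 1 = \sum_(u in X) isLeaf u +
    \sum_(u in X) \sum_(w | child w u && (w \in X)) 1)%N.
  move=> /eqP; rewrite eqn_add2r => /eqP h uX lu u'X lu'.
  apply/eqP; apply: contraT => uu'; move: h.
  by rewrite (bigD1 u) //= (bigD1 u') /= ?u'X 1?eq_sym // lu lu' addnA addnC; lia.
rewrite -big_split; apply: eq_bigr => v vX /=.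
have := vX; rewrite inE => /andP [vV vM].
case/or3P: (node_kind v) => iv.
- rewrite (negPf (info_leaf iv)) (big_pred1 (act s v)) // => w.
  rewrite inE /= andbA child_Vset_info //; case: eqP => //= ->.
  by rewrite (child_envset (strat_child sS vV iv)) vM (negPf (info_act iv)).
- rewrite (negPf (act_leaf iv)) (big_pred1 (mu v)) // => w.
  rewrite inE /= andbCA andbC child_envset_act //; case: eqP => //= ->.
  exact: Vset_act (env_child iv).
- rewrite iv big_pred0 ?addn0 // => w.
  by rewrite (negPf (contraL (@childN_leaf _ w v) iv)).
Qed.

Lemma play_spec : let: (u, z) := play s mu in
  [/\ z \in Aσ s, cand z & mu z = u].
Proof.
have rX : r \in X by rewrite inE root_Vset root_envset.
have := @walk_leaf D r r rX; rewrite /play.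
(* The initial last action [r] is a placeholder, admissible because the root is not a leaf. *)
rewrite (negPf (info_leaf (info_root G))) => /(_ (fun h : false => False_ind _ (notF h))).
case: walk => u z [|uX lu ->]; first by lia.
have := uX; rewrite inE => /andP [uV uM].
have ur : u != r by apply: contraTneq lu => ->; exact: info_leaf (info_root G).
have cu := child_par ur.
have ip : isAct (par u).
  case/or3P: (node_kind (par u)) => // ip; last by rewrite (negPf (childN_leaf cu)) in ip.
  by have := act_leaf (child_info_act ip cu); rewrite lu.
have pM := envset_par uM ur.
have mE : mu (par u) = u by move: uM; rewrite (child_envset cu) ip => /andP [_ /eqP].
by split; rewrite ?in_Aset_strat ?(Vset_par sS) // /cand ip pM mE.
Qed.

Lemma lastAct_in : lastAct s mu \in Aσ s.
Proof. by have := play_spec; rewrite /lastAct; case: play => u z []. Qed.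

Variable lam : node G -> R.

(** A loss for each action that depends on the environment only; it makes the loss of a strategy
    additive over its actions ([Loss_sum]). *)
Definition lossAct a : R := if cand a then lam (mu a) else 0.

(** A visited candidate leads to a leaf in [X]. That leaf is unique, so the last action encountered
    is the only candidate among the actions of [s]. *)
Lemma lossAct_lastAct a : a \in Aσ s ->
  (if a == lastAct s mu then Loss lam s mu else 0) = lossAct a.
Proof.
have := play_spec; rewrite /lastAct /Loss /lossAct; case: play => u z /=.
move=> [zA cz mz] aA; case: eqP => [->|/eqP az]; first by rewrite cz mz.
case: ifP => // ca; case/eqP: az.
have inX b : b \in Aσ s -> cand b -> mu b \in X.
  rewrite in_Aset_strat => /andP [bV ib] /and3P [_ be _].
  rewrite inE (Vset_act bV ib (env_child ib)) (child_envset (env_child ib)).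
  by rewrite be eqxx implybT.
have ia := ca; have iz := cz; move: ia iz => /and3P [ia _ la] /and3P [iz _ lz].
have h := leaf_unique (inX _ aA ca) la (inX _ zA cz) lz.
by have := env_child ia; rewrite h => /child_eq_par; apply; exact: env_child.
Qed.

Lemma Loss_sum : Loss lam s mu = \sum_(a in Aσ s) lossAct a.
Proof.
rewrite (eq_bigr (fun a => if a == lastAct s mu then Loss lam s mu else 0)).
  by rewrite (bigD1 _ lastAct_in) /= eqxx big1 ?addr0 // => a /andP [_ /negPf ->].
by move=> a /lossAct_lastAct.
Qed.

End Play.

End Environment.

(** This is [q_t] of the algorithm, extended to infosets, where it is the argument [x] of the
    update. *)
Definition pathProb pi v := \prod_(a | anc v a && isAct a) pi a.

Lemma pathProb_root pi : pathProb pi r = 1.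
Proof.
rewrite /pathProb big_pred0 // => a; rewrite anc_root; case: eqP => // ->.
by rewrite (negPf (info_act (info_root G))).
Qed.

Lemma pathProb_child pi w v : child w v ->
  pathProb pi w = (if isAct w then pi w else 1) * pathProb pi v.
Proof.
move=> cw; rewrite /pathProb.
have nw : ~~ anc v w by apply/negP => /anc_depth; rewrite (depth_child cw) ltnn.
case: ifPn => [iw|niw].
  rewrite (bigD1 w) /= ?anc_refl //; congr (_ * _); apply: eq_bigl => a.
  rewrite (anc_child _ cw); case: eqP => [->|] //=; first by rewrite andbF (negPf nw).
  by rewrite andbT.
rewrite mul1r; apply: eq_bigl => a; rewrite (anc_child _ cw).
by case: eqP => [->|] //=; rewrite (negPf niw) ?andbF.
Qed.

Lemma pathProb_gt0 pi v : (forall a, isAct a -> 0 < pi a) -> 0 < pathProb pi v.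
Proof. by move=> h; apply: prodr_gt0 => a /andP [_ /h]. Qed.

(* Making [pi] deterministic along the path to [a0] conditions the sampling on
   visiting [a0]. *)
Lemma marginal pi a0 : normalized pi -> isAct a0 ->
  \sum_(s in Sset G | a0 \in Vset s) sampleProb pi s = pathProb pi a0.
Proof.
move=> npi ia0.
pose pit a := if anc a0 (par a) then (anc a0 a)%:R else pi a : R.
have npit : normalized pit.
  move=> v iv; have [av|nav] := boolP (anc a0 v); last first.
    rewrite -(npi v iv); apply: eq_bigr => a /childP [_ pa].
    by rewrite /pit pa (negPf nav).
  have [|w cw aw] := anc_next av; first by apply: contraTneq ia0 => ->; exact: info_act.
  rewrite (bigD1 w) //= /pit; have /childP [_ ->] := cw; rewrite av aw.
  rewrite big1 ?addr0 // => a /andP [ca aw']; have /childP [_ ->] := ca; rewrite av.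
  case aa : (anc a0 a) => //; case/eqP: aw'.
  by apply: anc_depth_inj aa aw _; rewrite (depth_child cw) (depth_child ca).
rewrite -[RHS]mulr1 -(sum_sampleProb npit) mulr_sumr big_mkcondr /=.
apply: eq_bigr => s sS; rewrite !sampleProbE //.
case: ifPn => a0V; last first.
  (* A strategy that misses [a0] leaves the path to [a0] at some infoset, and its action there has
     weight [0]. *)
  suff [a aA /andP [ap na]] : exists2 a, a \in Aσ s & anc a0 (par a) && ~~ anc a0 a.
    by rewrite (bigD1 a) //= /pit ap (negPf na) mul0r mulr0.
  have H x : anc a0 x -> x \notin Vset s ->
      exists2 a, a \in Aσ s & anc a0 (par a) && ~~ anc a0 a.
    elim/node_ind: x => [|w v cw IH aw wV]; first by rewrite root_Vset.
    have av := anc_par cw aw.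
    have [vV|nvV] := boolP (v \in Vset s); last exact: IH.
    case/or3P: (node_kind v) => iv; last by rewrite (negPf (childN_leaf cw)) in iv.
      have ca := strat_child sS vV iv; exists (act s v).
        by rewrite in_Aset_strat strat_in ?strat_act.
      have /childP [_ ->] := ca; rewrite av /=; apply: contra wV => aa.
      rewrite (_ : w = act s v) ?strat_in //.
      by apply: anc_depth_inj aw aa _; rewrite (depth_child cw) (depth_child ca).
    by rewrite (Vset_act vV iv cw) in wV.
  exact: H (anc_refl a0) a0V.
have ancV x : anc a0 x -> x \in Vset s by exact: Vset_anc.
(* A strategy that visits [a0] contains the whole path, which supplies the factor [pathProb pi a0];
   on its other actions [pit] equals [pi]. *)
rewrite (bigID (fun a => anc a0 a)) /=; congr (_ * _).
  apply: eq_bigl => a; rewrite in_Aset_strat [RHS]andbC.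
  by case aa: (anc a0 a); rewrite ?andbF //= ancV // andbT.
rewrite [RHS](bigID (fun a => anc a0 a)) /= [X in X * _]big1 ?mul1r.
  apply: eq_bigr => a /andP []; rewrite in_Aset_strat => /andP [aV ia] na.
  rewrite /pit; case: ifP => // ap; case/negP: na.
  have iv := par_act ia; have ca := child_par (act_root ia).
  have [|w cw aw] := anc_next ap; first by apply: contraTneq ia0 => ->; exact: info_act.
  have := Vset_child_info sS (ancV _ ap) iv cw.
  have := Vset_child_info sS (ancV _ ap) iv ca.
  rewrite aV ancV // => /esym/eqP aE /esym/eqP wE.
  by rewrite (_ : a = w) // wE.
move=> a /andP []; rewrite in_Aset_strat => /andP [aV ia] aa.
by rewrite /pit (anc_par (child_par (act_root ia)) aa) aa.
Qed.

(** Each [n(a)] is the product over the infoset children of [a], so numerators and denominators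
    telescope: the initial sampling is uniform. *)
Lemma sampleProb_pi1 s : s \in Sset G -> sampleProb (@pi1 G R) s = (nfun r)%:R^-1.
Proof.
move=> sS; have n0 v : (nfun v)%:R != 0 :> R by rewrite pnatr_eq0 -lt0n nfun_gt0.
rewrite sampleProbE // prodf_div.
have := telescope_strat sS (op := *%R) (fun v => (nfun v)%:R : R) => /=.
set K := \prod_(a in Aσ s) \prod_(w | _) _.
have K0 : K != 0 by apply/prodf_neq0 => a _; apply/prodf_neq0 => w _.
rewrite mulrA => /(mulIf K0) h.
have -> : \prod_(a in Aσ s) (nfun (par a))%:R = \prod_(v in Nset s) (nfun v)%:R :> R.
  rewrite -(big_act sS); apply: eq_bigr => v; rewrite in_Nset => /andP [vV iv].
  by have /childP [_ ->] := strat_child sS vV iv.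
have -> : \prod_(a in Aσ s) (nfun a)%:R = K.
  apply: eq_bigr => a; rewrite in_Aset_strat => /andP [aV ia].
  by rewrite nfunE (negPf (act_info ia)) natr_prod.
by rewrite h invfM mulrCA divff // mulr1.
Qed.

Lemma pi1_gt0 a : 0 < @pi1 G R a.
Proof. by rewrite divr_gt0 // ltr0n nfun_gt0. Qed.

Lemma normalized_pi1 : normalized (@pi1 G R).
Proof.
move=> v iv; have n0 : (nfun v)%:R != 0 :> R by rewrite pnatr_eq0 -lt0n nfun_gt0.
have nE : (nfun v)%:R = \sum_(a | child a v) (nfun a)%:R :> R.
  by rewrite nfunE iv natr_sum.
rewrite -[RHS](divff n0) {1}nE mulr_suml.
by apply: eq_bigr => a /childP [_ pa]; rewrite /pi1 pa.
Qed.

(** The uniform probabilities [1 / n(r)] sum to [1] over the reduced strategies. *)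
Lemma card_Sset : #|Sset G| = nfun r.
Proof.
have n0 : (nfun r)%:R != 0 :> R by rewrite pnatr_eq0 -lt0n nfun_gt0.
have := sum_sampleProb normalized_pi1.
rewrite (eq_bigr (fun _ => (nfun r)%:R^-1)) => [|s]; last exact: sampleProb_pi1.
rewrite sumr_const -[X in X = _]mulr_natl => /(congr1 (fun x : R => x * (nfun r)%:R)).
rewrite divfK // mul1r => /eqP.
by rewrite eqr_nat => /eqP.
Qed.

End Real.
End Recursions.

(** * The update as exponential weights *)

Section Update.
Variables (G : gameTree) (R : realType) (T : nat) (eps : R).
Implicit Types (u v w a b : node G).
Local Notation r := (root G).
Local Notation D := #|node G|.
Local Notation anc := (fconnect (@par G)).
Local Notation eta := (etaP G T eps).
Local Notation gamma := (gammaP G T eps).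

(** Strict positivity survives every update and makes the logarithms of sampling probabilities
    meaningful. *)
Definition isPolicy (pi : node G -> R) :=
  (forall a, isAct a -> 0 < pi a) /\ normalized pi.

Lemma isPolicy_le1 pi a : isPolicy pi -> isAct a -> pi a <= 1.
Proof.
move=> [pi0 npi] ia; have ca := child_par (act_root ia).
rewrite -(npi _ (par_act ia)) (bigD1 a) //= lerDl sumr_ge0 // => b /andP [cb _].
by rewrite ltW // pi0 // (child_info_act (par_act ia)).
Qed.

Variables (pi : node G -> R) (s : {ffun node G -> option (node G)}) (d : node G -> R).
Hypotheses (pol : isPolicy pi) (sS : s \in Sset G).

Lemma upd_stable k k' v x : v \in Vset s -> isInfo v ->
  (D - depth v <= k)%N -> (D - depth v <= k')%N ->
  upd T eps pi s d k v x = upd T eps pi s d k' v x.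
Proof.
elim: k k' v x => [|k IH] [|k'] v x vV iv h h'; have := depth_lt v => dv; try lia.
rewrite /= -/(act s v).
suff -> : [seq (w, upd T eps pi s d k w (pi (act s v) * x))
          | w <- enum (node G) & child w (act s v) && isInfo w] =
  [seq (w, upd T eps pi s d k' w (pi (act s v) * x))
          | w <- enum (node G) & child w (act s v) && isInfo w] by [].
apply/eq_in_map => w; rewrite mem_filter => /andP [/andP [cw iw] _].
congr (_, _); have dw := depth_child cw.
have da := depth_child (strat_child sS vV iv).
apply: IH => //; try lia.
by apply: Vset_act cw; [exact: strat_in|exact: strat_act].
Qed.

(** Recursive calls multiply [x] by the policy along the path, so at [v] it is always
    [pathProb pi v]. *)
Let U v := upd T eps pi s d D v (pathProb pi v).

(** The returned value [psi_t], extended by [1] to the infosets at which the policy does not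
    change. *)
Definition updZ v := if v \in Nset s then (U v).1 else 1.

Definition updK a := \prod_(w | child w a && isInfo w) updZ w.

(** An importance-weighted estimate of the noisy loss; [gamma * beta] keeps the denominator away
    from [0] at the price of a bias. *)
Definition estLoss a := if a \in Aσ s then d a / (gamma * beta R a + pathProb pi a) else 0.

Definition updOmega v := expR (- (eta * estLoss (act s v))) * updK (act s v).

Lemma updE v : v \in Vset s -> isInfo v ->
  U v = (1 - (1 - updOmega v) * pi (act s v),
     fun a => if child a v then
         Some ((if a == act s v then updOmega v * pi a else pi a)
               / (1 - (1 - updOmega v) * pi (act s v)))
       else foldr (fun p acc => if p.2.2 a is Some y then Some y else acc) None
              [seq (w, U w) | w <- enum (node G) & child w (act s v) && isInfo w]).
Proof.
move=> vV iv; rewrite {1}/U (@upd_stable D D.+1) //; try lia.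
rewrite /= -/(act s v); have cb := strat_child sS vV iv; have ib := strat_act sS vV iv.
have bV := strat_in sS vV iv.
have xE : pi (act s v) * pathProb pi v = pathProb pi (act s v).
  by rewrite (pathProb_child _ cb) ib.
rewrite xE.
have -> : [seq (w, upd T eps pi s d D w (pathProb pi (act s v)))
    | w <- enum (node G) & child w (act s v) && isInfo w] =
    [seq (w, U w) | w <- enum (node G) & child w (act s v) && isInfo w].
  apply/eq_in_map => w; rewrite mem_filter => /andP [/andP [cw iw] _].
  by rewrite /U (pathProb_child _ cw) (negPf (info_act iw)) mul1r.
suff -> : expR (- (eta * d (act s v)) / (gamma * beta R (act s v) + pathProb pi (act s v))) *
   \prod_(p <- [seq (w, U w) | w <- enum (node G) & child w (act s v) && isInfo w]) p.2.1
   = updOmega v by [].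
rewrite /updOmega /estLoss in_Aset_strat bV ib /= mulNr mulrA; congr (_ * _).
rewrite big_map big_filter big_enum_cond; apply: eq_big => w; first by rewrite inE.
by rewrite inE /= => /andP [cw iw]; rewrite /updZ in_Nset iw (Vset_act bV ib cw).
Qed.

Lemma updZE v : v \in Vset s -> isInfo v ->
  updZ v = 1 - (1 - updOmega v) * pi (act s v).
Proof. by move=> vV iv; rewrite /updZ in_Nset vV iv updE. Qed.

Lemma updZ_gt0 v : 0 < updZ v.
Proof.
have [n] := ubnP (D - depth v); elim: n v => // n IH v h.
rewrite /updZ in_Nset; case: ifPn => // /andP [vV iv]; rewrite updE //=.
have cb := strat_child sS vV iv; have ib := strat_act sS vV iv.
have p0 := pol.1 _ ib; have p1 := isPolicy_le1 pol ib.
(* The value is a convex combination of [updOmega v] and [1], with weight [pi (act s v)] on the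
   former. *)
suff o0 : 0 < updOmega v by nra.
rewrite mulr_gt0 ?expR_gt0 //; apply: prodr_gt0 => w /andP [cw iw]; apply: IH.
by have := depth_lt w; have := depth_child cw; have := depth_child cb; lia.
Qed.

Lemma updK_gt0 a : 0 < updK a.
Proof. by apply: prodr_gt0 => w _; exact: updZ_gt0. Qed.

Lemma foldr_Some (A : Type) (B : eqType) (f : B -> option A) (g : pred B) (y : A)
    (l : seq B) : {in l, forall p, f p = if g p then Some y else None} ->
  foldr (fun p acc => if f p is Some z then Some z else acc) None l =
  if has g l then Some y else None.
Proof.
elim: l => //= p l IH h; rewrite h ?mem_head //; case: ifP => //= _.
by rewrite IH // => q ql; rewrite h // in_cons ql orbT.
Qed.

Let rho a := (if a == act s (par a) then updOmega (par a) * pi a else pi a)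
             / updZ (par a).

Lemma upd_policy v a : v \in Vset s -> isInfo v -> isAct a ->
  (U v).2 a = if (par a \in Nset s) && anc (par a) v then Some (rho a) else None.
Proof.
have [n] := ubnP (D - depth v); elim: n v => // n IH v h vV iv ia.
rewrite updE //=; case: ifPn => [ca|nca].
  by have /childP [_ pa] := ca; rewrite /rho pa in_Nset vV iv anc_refl updZE.
have cb := strat_child sS vV iv; have ib := strat_act sS vV iv.
have bV := strat_in sS vV iv; set b := act s v in cb ib bV *.
rewrite foldr_map (@foldr_Some _ _ (fun w => (U w).2 a)
    (fun w => (par a \in Nset s) && anc (par a) w) (rho a)); last first.
  move=> w; rewrite mem_filter => /andP [/andP [cw iw] _]; apply: IH => //.
    by have := depth_lt w; have := depth_child cw; have := depth_child cb; lia.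
  exact: Vset_act cw.
congr (if _ then _ else _); apply/hasP/andP => [[w]|[pN pv]].
  rewrite mem_filter => /andP [/andP [cw iw] _] /andP [-> pw]; split => //.
  exact: anc_par cb (anc_par cw pw).
have := pN; rewrite in_Nset => /andP [pV ip].
have [|w1 cw1 pw1] := anc_next pv.
  by apply: contra nca => /eqP <-; apply: child_par; exact: act_root.
have w1b : w1 = b.
  by apply/eqP; rewrite -(Vset_child_info sS vV iv cw1); exact: Vset_anc pw1.
rewrite {}w1b {w1 cw1} in pw1.
have [|w cw pw] := anc_next pw1; first by apply: contraTneq ip => ->; exact: act_info.
exists w => /=; last first.
  by rewrite pV ip.
rewrite mem_filter mem_enum andbT cw /=; case/orP: (child_act ib cw) => // lw.
have [pw'|npw] := eqVneq (par a) w; first by rewrite -pw'.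
by have [w' cw' _] := anc_next pw npw; rewrite (negPf (childN_leaf cw')) in lw.
Qed.

Local Notation newpi := (newPolicy T eps pi s d).

Lemma newPolicy_cases a : isAct a ->
  newpi a = if par a \in Nset s then rho a else pi a.
Proof.
move=> ia; rewrite /newPolicy -[X in upd _ _ _ _ _ _ _ X](pathProb_root pi) -/(U r).
rewrite upd_policy ?root_Vset ?info_root // fconnect_root andbT.
by case: ifP.
Qed.

(** One formula covers all cases: at an action outside [s] the estimate is [0] and [updK] is [1],
    and at an unvisited infoset [updZ] is [1] too. *)
Lemma newPolicyE a : isAct a ->
  newpi a = pi a * expR (- (eta * estLoss a)) * updK a / updZ (par a).
Proof.
move=> ia; rewrite newPolicy_cases //.
have outV : a \notin Vset s -> estLoss a = 0 /\ updK a = 1.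
  move=> aV; rewrite /estLoss in_Aset_strat (negPf aV); split => //.
  rewrite /updK big1 // => w /andP [cw iw]; rewrite /updZ in_Nset.
  by rewrite (negPf (contra (Vset_child sS cw) aV)).
have ca := child_par (act_root ia).
case: ifPn => [|pN].
  rewrite in_Nset /rho => /andP [pV ip]; congr (_ / _).
  have := Vset_child_info sS pV ip ca; case: eqP => [aE aV|ne aV].
    by rewrite /updOmega -aE mulrC mulrA.
  by have [|-> ->] := outV; rewrite ?aV // mulr0 oppr0 expR0 !mulr1.
have aV : a \notin Vset s.
  by apply: contra pN => aV; rewrite in_Nset (Vset_child sS ca aV) par_act.
have [-> ->] := outV aV; rewrite /updZ (negPf pN).
by rewrite mulr0 oppr0 expR0 !mulr1 divr1.
Qed.

Lemma newPolicy_policy : isPolicy newpi.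
Proof.
split => [a ia|v iv].
  rewrite newPolicyE // !mulr_gt0 ?invr_gt0 ?updZ_gt0 ?updK_gt0 ?expR_gt0 //.
  exact: pol.1.
have [vN|nvN] := boolP (v \in Nset s); last first.
  rewrite -(pol.2 v iv); apply: eq_bigr => a ca; rewrite newPolicy_cases.
    by have /childP [_ ->] := ca; rewrite (negPf nvN).
  exact: child_info_act ca.
have := vN; rewrite in_Nset => /andP [vV _].
have cb := strat_child sS vV iv.
have Z0 : updZ v != 0 by rewrite gt_eqF ?updZ_gt0.
rewrite (eq_bigr (fun a => (if a == act s v then updOmega v * pi a else pi a) / updZ v)).
  rewrite -mulr_suml; apply: (mulIf Z0); rewrite divfK // mul1r updZE //.
  have := pol.2 v iv; rewrite (bigD1 (act s v)) //= => h.
  rewrite (bigD1 (act s v)) //= eqxx; under eq_bigr => a /andP [_ /negPf ->] do [].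
  move: h; set S := \sum_(_ | _) _ => h.
  have -> : S = 1 - pi (act s v) by rewrite -h addrAC subrr add0r.
  by ring.
move=> a ca; rewrite newPolicy_cases; last exact: child_info_act ca.
by have /childP [_ pa] := ca; rewrite /rho pa vN.
Qed.

(** Along [t] the factors [updK a / updZ (par a)] telescope to [1 / updZ r]. *)
Lemma sampleProb_new t : t \in Sset G ->
  sampleProb newpi t =
  sampleProb pi t * expR (- (eta * \sum_(a in Aσ t) estLoss a)) / updZ r.
Proof.
move=> tS; rewrite !sampleProbE //.
rewrite (eq_bigr (fun a => pi a * expR (- (eta * estLoss a)) * updK a / updZ (par a))).
  rewrite prodf_div !big_split /=.
  have -> : \prod_(a in Aσ t) updZ (par a) = \prod_(v in Nset t) updZ v.
    rewrite -(big_act tS); apply: eq_bigr => v; rewrite in_Nset => /andP [vV iv].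
    by have /childP [_ ->] := strat_child tS vV iv.
  have := telescope_strat tS (op := *%R) updZ => /=; rewrite -/(updK _).
  set K := \prod_(a in Aσ t) updK a => h.
  have K0 : K != 0 by rewrite gt_eqF // prodr_gt0 // => a _; exact: updK_gt0.
  move: h; rewrite mulrA => /(mulIf K0) ->.
  rewrite -expR_sum sumrN mulr_sumr invfM -!mulrA; congr (_ * (_ * _)).
  by rewrite mulrCA divff // mulr1.
by move=> a; rewrite in_Aset_strat => /andP [_ ia]; rewrite newPolicyE.
Qed.

(** Read off from the total mass [1] of the new distribution. *)
Lemma updZ_root : updZ r =
  \sum_(t in Sset G) sampleProb pi t * expR (- (eta * \sum_(a in Aσ t) estLoss a)).
Proof.
have Z0 : updZ r != 0 by rewrite gt_eqF ?updZ_gt0.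
have := sum_sampleProb newPolicy_policy.2.
rewrite (eq_bigr _ sampleProb_new) -mulr_suml => /(congr1 (fun x : R => x * updZ r)).
by rewrite divfK // mul1r.
Qed.

End Update.

(** * Laplace integrals *)

Section Laplace.
Local Open Scope classical_set_scope.
Variable R : realType.
Local Notation leb := (@lebesgue_measure R).
Implicit Types (f g : R -> \bar R) (x y A B C J M eps : R).

(* Unlike [ge0_le_integral], no measurability: the integral of a nonnegative
   function is a supremum over the simple functions below it. *)
Lemma ge0_le_integralT f g : (forall x, 0 <= f x)%E -> (forall x, f x <= g x)%E ->
  (\int[leb]_x f x <= \int[leb]_x g x)%E.
Proof.
move=> f0 fg; have g0 x : (0 <= g x)%E by apply: le_trans (fg x).
rewrite !ge0_integralTE //; apply: le_ereal_sup => _ [h hf <-].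
by exists h => // x; exact: le_trans (fg x).
Qed.

Let poly A B C x := A + B * x + C * x ^+ 2.

(** The primitive of [c / 2 * expR (- c * x) * poly A B C x] found by integrating by parts;
    [c = eps / 2] is the rate of the noise. *)
Let prim c A B C x := - 2^-1 * expR (- c * x) *
  (A + B * x + B / c + C * (x ^+ 2 + 2 * x / c + 2 / c ^+ 2)).

Let dprim c A B C x : 0 < c ->
  is_derive x (1 : R) (prim c A B C) (c / 2 * expR (- c * x) * poly A B C x).
Proof.
move=> c0; have cn0 : c != 0 by rewrite gt_eqF.
rewrite /prim; apply: is_derive_eq.
rewrite /poly /GRing.scale /=.
by field.
Qed.

Let continuous_derivable (f : R -> R) : (forall x, derivable f x 1) -> continuous f.
Proof. by move=> df x; apply: differentiable_continuous; apply/derivable1_diffP. Qed.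

Let continuous_expM c J : continuous (fun x => c / 2 * expR (- c * x) * J).
Proof. by apply: continuous_derivable => x; exact: ex_derive. Qed.

Let continuous_exp_poly c A B C :
  continuous (fun x => c / 2 * expR (- c * x) * poly A B C x).
Proof. by apply: continuous_derivable => x; rewrite /poly; exact: ex_derive. Qed.

Let integral_0M c A B C M : 0 < c -> 0 < M ->
  (\int[leb]_(x in `[0%R, M]) (c / 2 * expR (- c * x) * poly A B C x)%:E =
   (prim c A B C M - prim c A B C 0)%:E)%E.
Proof.
move=> c0 M0; have d x := @dprim c A B C x c0.
have cF : continuous (prim c A B C).
  by apply: continuous_derivable => x; exact: ex_derive.
rewrite EFinB; apply: continuous_FTC2 => //.
- by apply: continuous_subspaceT; exact: continuous_exp_poly.
- split; first by move=> x _; exact: ex_derive.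
  + by apply: cvg_at_right_filter; exact: cF.
  + by apply: cvg_at_left_filter; exact: cF.
- by move=> x _; rewrite derive1E derive_val.
Qed.

Let integral_My c J M : 0 < c -> 0 <= J ->
  (\int[leb]_(x in `[M, +oo[) (c / 2 * expR (- c * x) * J)%:E =
   (J / 2 * expR (- c * M))%:E)%E.
Proof.
move=> c0 J0; pose F x := - (J / 2) * expR (- c * x).
have d x : is_derive x (1 : R) F (c / 2 * expR (- c * x) * J).
  by rewrite /F; apply: is_derive_eq; rewrite /GRing.scale /=; ring.
have cF : continuous F.
  by apply: continuous_derivable => y; exact: ex_derive.
rewrite (@ge0_continuous_FTC2y _ _ F M 0) //.
- by rewrite sub0e -EFinN /F; congr EFin; ring.
- by move=> x _; rewrite !mulr_ge0 ?expR_ge0 // ltW.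
- by apply: continuous_subspaceT; exact: continuous_expM.
- rewrite -[X in _ --> X](mulr0 (- (J / 2))) /F; apply: cvgM; first exact: cvg_cst.
  rewrite (_ : (fun x => expR (- c * x)) = (fun z => expR (- z)) \o (fun z => c * z)).
    apply: (@cvg_comp _ _ _ _ _ _ (pinfty_nbhs R)); last exact: cvgr_expR.
    exact: gt0_cvgMry.
  by apply: eq_fun => x; rewrite mulNr.
- by apply: cvg_at_right_filter; exact: cF.
- by move=> x _; rewrite derive1E derive_val.
Qed.

Let continuous_Qlap eps : continuous (Qlap eps).
Proof.
move=> x; rewrite /Qlap.
apply: (@continuous_comp _ _ _ (@Num.norm R R) (fun z => eps / 4 * expR (- (eps / 2) * z))).
  exact: norm_continuous.
by apply: continuous_derivable => z; exact: ex_derive.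
Qed.

Let eq_int (D : set R) (g f : R -> R) : (forall x, D x -> f x = g x) ->
  (\int[leb]_(x in D) (f x)%:E = \int[leb]_(x in D) (g x)%:E)%E.
Proof. by move=> h; apply: eq_integral => x; rewrite inE => /h ->. Qed.

(** The density has total mass [1]; folding it onto the positive half-line removes the absolute
    value. *)
Lemma laplace_le eps f J : 0 < eps -> (0 <= J) -> (forall x, 0 <= f x <= J%:E)%E ->
  (\int[leb]_x ((Qlap eps x)%:E * f x) <= J%:E)%E.
Proof.
move=> e0 J0 hf.
have Q0 x : 0 <= Qlap eps x by rewrite mulr_ge0 ?expR_ge0 // divr_ge0 // ltW.
apply: (@le_trans _ _ (\int[leb]_x (Qlap eps x * J)%:E)%E).
  apply: ge0_le_integralT => x; have /andP [h1 h2] := hf x.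
    by rewrite mule_ge0 // lee_fin.
  by rewrite [X in (_ <= X)%E]EFinM; apply: lee_wpmul2l => //; rewrite lee_fin.
rewrite ge0_symfun_integralT => [|x||x /=]; last 3 first.
- by rewrite mulr_ge0.
- by move=> x; apply: (@cvgMl _ R^o); exact: continuous_Qlap.
- by rewrite /Qlap normrN.
rewrite -set_itvcy (eq_int (g := fun x => ((eps / 2) / 2 * expR (- (eps / 2) * x) * J))).
  rewrite integral_My ?divr_gt0 // mulr0 expR0 -EFinM lee_fin; lra.
move=> x; rewrite /= in_itv /= andbT => x0.
by rewrite /Qlap ger0_norm //; congr (_ * _ * _); field.
Qed.

(** Replace [f] by the quadratic on [[-M, M]] and by [J] outside. The linear term cancels by
    symmetry, [8 / eps ^+ 2] is the variance of the density, and its two tails together have mass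
    [expR (- (eps / 2 * M))]. *)
Lemma laplace_quadratic eps M A B C J f : 0 < eps -> 0 < M -> 0 <= A -> 0 <= C -> 0 <= J ->
  (forall x, 0 <= f x)%E ->
  (forall x, `|x| <= M -> (f x <= (A + B * x + C * x ^+ 2)%:E)%E) ->
  (forall x, (f x <= J%:E)%E) ->
  (\int[leb]_x ((Qlap eps x)%:E * f x) <=
    (A + C * (8 / eps ^+ 2) + J * expR (- (eps / 2 * M)))%:E)%E.
Proof.
move=> e0 M0 A0 C0 J0 f0 fM fJ; set c := eps / 2.
have c0 : 0 < c by rewrite divr_gt0.
have Q0 x : 0 <= Qlap eps x by rewrite mulr_ge0 ?expR_ge0 // divr_ge0 // ltW.
have mQ : measurable_fun [set: R] (Qlap eps).
  exact: continuous_measurable_fun (@continuous_Qlap _).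
have mpoly : measurable_fun [set: R] (poly A B C).
  by apply: continuous_measurable_fun; apply: continuous_derivable => x;
    rewrite /poly; exact: ex_derive.
pose g x := Qlap eps x * (if `|x| <= M then poly A B C x else J).
have p0 x : `|x| <= M -> 0 <= poly A B C x.
  by move=> xM; rewrite -lee_fin; apply: le_trans (fM _ xM); exact: f0.
have g0 x : 0 <= g x by rewrite mulr_ge0 //; case: ifP => // /p0.
have mg : measurable_fun [set: R] g.
  apply: measurable_funM => //; apply: measurable_fun_ifT => //.
  by apply: measurable_fun_ler.
apply: (@le_trans _ _ (\int[leb]_x (g x)%:E)%E).
  apply: ge0_le_integralT => x; first by rewrite mule_ge0 // lee_fin.
  rewrite [X in (_ <= X)%E]EFinM; apply: lee_wpmul2l; first by rewrite lee_fin.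
  by case: ifPn => [/fM//|_]; exact: fJ.
have mgD (X : set R) : measurable_fun X (EFin \o g).
  by apply: measurable_funTS; apply/measurable_EFinP.
rewrite -(setUv `[- M, M]) ge0_integral_setU //=; last 4 first.
- exact: measurableC.
- exact: mgD.
- by move=> x _; rewrite lee_fin.
- exact/disj_setPCl.
rewrite setCitv /= ge0_integral_setU //=; last 3 first.
- exact: mgD.
- by move=> x _; rewrite lee_fin.
- apply/disj_setPS => x /= []; rewrite !in_itv /= andbT => h1 h2.
  lra.
have negE x : x <= 0 -> Qlap eps x = c / 2 * expR (- c * - x).
  by move=> x0; rewrite /Qlap ler0_norm // /c; congr (_ * _); field.
have posE x : 0 <= x -> Qlap eps x = c / 2 * expR (- c * x).
  by move=> x0; rewrite /Qlap ger0_norm // /c; congr (_ * _); field.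
have mE (p : R -> R) (X : set R) : continuous p -> measurable_fun X (fun x : R => (p x)%:E).
  by move=> cp; apply: measurable_funTS; apply/measurable_EFinP; exact: continuous_measurable_fun.
have -> : (\int[leb]_(x in `[(- M)%R, M]) (g x)%:E =
   (prim c A B C M - prim c A B C 0 + (prim c A (- B) C M - prim c A (- B) C 0))%:E)%E.
  rewrite (@itv_bndbnd_setU _ _ (BLeft (- M)) (BLeft 0) (BRight M)); last 2 first.
  - by rewrite bnd_simp oppr_le0 ltW.
  - by rewrite bnd_simp ltW.
  rewrite ge0_integral_setU //=; last 3 first.
  - exact: mgD.
  - by move=> x _; rewrite lee_fin.
  - apply/disj_setPS => x /= []; rewrite !in_itv /= => /andP [_ h1] /andP [h2 _]; lra.
  rewrite addeC EFinD; congr (_ + _)%E.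
    rewrite -(integral_0M _ _ _ c0 M0); apply: eq_int => x; rewrite /= in_itv /= => /andP [x0 xM].
    by rewrite /g ger0_norm // xM posE.
  (* Reflection maps the negative half to the positive one and turns [B] into [- B]. *)
  pose G x := c / 2 * expR (c * x) * poly A B C x.
  have cG : continuous G.
    by apply: continuous_derivable => x; rewrite /G /poly; exact: ex_derive.
  rewrite (eq_int (g := G)) => [|x]; last first.
    rewrite /= in_itv /= => /andP [xM x0].
    by rewrite /g ltr0_norm // lerNl xM negE ?mulrNN // ltW.
  rewrite integral_itv_bndo_bndc; last exact: mE.
  rewrite -[X in `[_, X]]oppr0 integration_by_substitution_oppr ?ltW //; last first.
    exact: continuous_subspaceT.
  rewrite -(integral_0M _ _ _ c0 M0); apply: eq_int => x _ /=.
  by rewrite /G /poly mulrN mulNr; ring.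
have -> : (\int[leb]_(x in `]-oo, (- M)%R[) (g x)%:E = (J / 2 * expR (- c * M))%:E)%E.
  pose G x := c / 2 * expR (c * x) * J.
  have cG : continuous G.
    by apply: continuous_derivable => x; rewrite /G; exact: ex_derive.
  rewrite (eq_int (g := G)) => [|x]; last first.
    rewrite /= in_itv /= => xM; have x0 : x < 0 by lra.
    rewrite /g ltr0_norm // lerNl leNgt xM negE ?mulrNN // ltW //.
  rewrite integral_itv_bndo_bndc; last exact: mE.
  rewrite ge0_integration_by_substitutionNy; last 2 first.
  - exact: continuous_subspaceT.
  - by move=> x _; rewrite !mulr_ge0 ?expR_ge0 // ltW.
  rewrite -(integral_My _ c0 J0); apply: eq_int => x _ /=.
  by rewrite /G mulrN mulNr.
have -> : (\int[leb]_(x in `]M, +oo[) (g x)%:E = (J / 2 * expR (- c * M))%:E)%E.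
  rewrite (eq_int (g := fun x => c / 2 * expR (- c * x) * J)) => [|x]; last first.
    rewrite /= in_itv /= andbT => xM; have x0 : 0 < x by lra.
    by rewrite /g gtr0_norm // leNgt xM posE // ltW.
  rewrite integral_itv_obnd_cbnd; last exact: mE.
  exact: integral_My.
rewrite -!EFinD lee_fin mulNr /prim !mulr0 expR0.
have E0 := expR_gt0 (- c * M); rewrite mulNr in E0 *.
have cE : 8 / eps ^+ 2 = 2 / c ^+ 2 by rewrite /c; field; rewrite gt_eqF.
rewrite cE; move: (expR _) E0 => E E0.
(* This is the exact gap between the bound and the integral: what the quadratic would contribute
   beyond [M]. *)
have h1 : 0 <= E * (A + C * (M ^+ 2 + 2 * M / c + 2 / c ^+ 2)).
  apply: mulr_ge0; first exact: ltW.
  apply: addr_ge0 => //; apply: mulr_ge0 => //.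
  by rewrite !addr_ge0 ?sqr_ge0 // divr_ge0 ?mulr_ge0 ?sqr_ge0 ?ler0n // ltW.
rewrite -subr_ge0; apply: le_trans h1 _; rewrite le_eqVlt; apply/orP; left; apply/eqP.
by field; rewrite gt_eqF.
Qed.

End Laplace.

(** * Quadratic bounds on the exponential *)

Section ExpBounds.
Local Open Scope classical_set_scope.
Variable R : realType.
Implicit Types x y : R.

Lemma expR_ge_quadratic x : 0 <= x -> 1 + x + x ^+ 2 / 2 <= expR x.
Proof.
move=> x0; apply: limr_ge; first exact: is_cvg_series_exp_coeff.
suff h n : (3 <= n)%N -> 1 + x + x ^+ 2 / 2 <= series (exp_coeff x) n.
  by near=> n; apply: h; near: n; exact: nbhs_infty_ge.
elim: n => // n IH; rewrite leq_eqVlt => /predU1P [<-|].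
  rewrite /series /= !big_nat_recr //= big_geq //= /exp_coeff /= expr0 expr1.
  by rewrite !factS fact0; lra.
rewrite ltnS => /IH h; rewrite /series /= big_nat_recr //=; apply: le_trans h _.
by rewrite lerDl /exp_coeff /= divr_ge0 ?exprn_ge0 ?ler0n.
Unshelve. all: by end_near. Qed.

Lemma expR1_ge : 5 / 2 <= expR (1 : R).
Proof. by apply: le_trans (expR_ge_quadratic _) => //; rewrite expr1n; lra. Qed.

(* For [0 <= y <= 1] compare the exponential series of [y] and [1] termwise. *)
Lemma expR_le_quadratic y : y <= 1 -> expR y <= 1 + y + (expR 1 - 2) * y ^+ 2.
Proof.
move=> y1; have [y0|y0] := lerP 0 y.
  pose u n := 1 + y + y ^+ 2 * (series (exp_coeff (1 : R)) n - 2) - series (exp_coeff y) n.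
  have cu : u @ \oo --> 1 + y + y ^+ 2 * (expR 1 - 2) - expR y.
    apply: cvgB; last exact: is_cvg_series_exp_coeff.
    apply: cvgD; first exact: cvg_cst.
    apply: cvgM; first exact: cvg_cst.
    apply: cvgB; last exact: cvg_cst.
    exact: is_cvg_series_exp_coeff.
  rewrite -subr_ge0 (mulrC (expR 1 - 2)) -(cvg_lim _ cu) //.
  apply: limr_ge; first by apply: cvgP cu.
  suff h n : (2 <= n)%N -> 0 <= u n.
    by near=> n; apply: h; near: n; exact: nbhs_infty_ge.
  rewrite /u; elim: n => // n IH; rewrite leq_eqVlt => /predU1P [<-|].
    rewrite /series /= !big_nat_recr //= !big_geq //= /exp_coeff /= !expr0 !expr1.
    by rewrite !factS fact0; lra.
  rewrite ltnS => n2; have {IH} := IH n2; rewrite /series /= !big_nat_recr //=.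
  rewrite /exp_coeff /= expr1n.
  have h : 0 <= (y ^+ 2 - y ^+ n) / n`!%:R.
    by rewrite divr_ge0 ?ler0n // subr_ge0 ler_wiXn2l.
  move: h; rewrite mulrBl mul1r; move: (\sum_(_ <= _ < _) _) (\sum_(_ <= _ < _) _) => a b.
  lra.
(* For [y < 0] the lower bound at [- y] is inverted, since [(1 + y + y^2/2) * (1 - y + y^2/2) = 1 +
   y^4/4 >= 1]; then [1/2 <= e - 2]. *)
have := @expR_ge_quadratic (- y); rewrite sqrrN oppr_ge0 ltW // => /(_ isT) h.
have h1 := expR1_ge; have h2 := expR_gt0 y.
have h3 : expR y * expR (- y) = 1 by rewrite -expRD subrr expR0.
have h4 : expR y <= 1 + y + y ^+ 2 / 2.
  have h5 : 0 <= 1 + y + y ^+ 2 / 2 by have := sqr_ge0 (1 + y); nra.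
  have h6 : 1 <= (1 + y + y ^+ 2 / 2) * (1 - y + y ^+ 2 / 2).
    by have := sqr_ge0 (y ^+ 2); nra.
  have h7 : 0 < 1 - y + y ^+ 2 / 2 by have := sqr_ge0 y; lra.
  rewrite -(ler_pM2r h7); apply: le_trans h6.
  by rewrite -[X in _ <= X]h3 ler_pM2l.
by apply: le_trans h4 _; have := sqr_ge0 y; nra.
Unshelve. all: by end_near. Qed.

End ExpBounds.

(** * Integration over all noises of a trial *)

Section Noise.
Variables (G : gameTree) (R : realType) (eps : R).
Hypothesis eps0 : 0 < eps.
Implicit Types (l : seq (node G)) (phi : node G -> R) (a b : node G).

Definition upd1 phi a (y : R) : node G -> R := fun c => if c == a then y else phi c.

Lemma noiseInt_ge0 l F phi : (forall psi, 0 <= F psi)%E -> (0 <= noiseInt eps l F phi)%E.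
Proof.
move=> F0; elim: l phi => //= a l IH phi; apply: integral_ge0 => y _.
by rewrite mule_ge0 // lee_fin mulr_ge0 ?expR_ge0 // divr_ge0 // ltW.
Qed.

Lemma noiseInt_le l F phi (J : R) : (forall psi, 0 <= F psi <= J%:E)%E ->
  (noiseInt eps l F phi <= J%:E)%E.
Proof.
move=> FJ; have J0 : 0 <= J.
  by rewrite -lee_fin; have /andP [h1 h2] := FJ phi; exact: le_trans h2.
elim: l phi => [|a l IH] phi /=; first by case/andP: (FJ phi).
apply: laplace_le => // y; rewrite IH andbT; apply: noiseInt_ge0 => psi.
by case/andP: (FJ psi).
Qed.

Definition zero_on l phi : node G -> R := fun c => if c \in l then 0 else phi c.

(* The terms of [H] that are linear in a noise integrate to zero over the symmetric
   event that all noises are at most [M] in absolute value. *)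
Lemma noiseInt_quadratic l (F : (node G -> R) -> \bar R) (H : (node G -> R) -> R)
    (C : node G -> R) (J M : R) phi :
  uniq l -> 0 < M -> 0 <= J -> (forall a, a \in l -> 0 <= C a) ->
  (forall psi, 0 <= F psi <= J%:E)%E ->
  (forall psi a, a \in l -> exists B, forall y,
     H (upd1 psi a y) = H (upd1 psi a 0) + B * y + C a * y ^+ 2) ->
  (forall psi, (forall a, a \in l -> `|psi a| <= M) ->
     (forall a, a \notin l -> psi a = phi a) -> (F psi <= (H psi)%:E)%E) ->
  (noiseInt eps l F phi <= (H (zero_on l phi) + (\sum_(a <- l) C a) * (8 / eps ^+ 2)
     + (size l)%:R * (J * expR (- (eps / 2 * M))))%:E)%E.
Proof.
move=> ul M0 J0 C0 FJ HB FH; elim: l phi ul C0 HB FH => [|a l IH] phi /=.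
  move=> _ _ _ FH; rewrite big_nil !mul0r !addr0.
  have -> : zero_on [::] phi = phi by apply/funext => c.
  exact: FH.
move=> /andP [al ul] C0 HB FH.
set X := _ * (8 / eps ^+ 2); pose Y := (\sum_(b <- l) C b) * (8 / eps ^+ 2)
     + (size l)%:R * (J * expR (- (eps / 2 * M))).
have zE y : zero_on l (upd1 phi a y) = upd1 (zero_on (a :: l) phi) a y.
  apply/funext => c; rewrite /zero_on /upd1 in_cons.
  by case: eqP => [->|] //=; rewrite (negPf al).
have z0 : upd1 (zero_on (a :: l) phi) a 0 = zero_on (a :: l) phi.
  by apply/funext => c; rewrite /zero_on /upd1 in_cons; case: eqP.
have [B HBa] := HB (zero_on (a :: l) phi) a (mem_head _ _).
have Y0 : 0 <= Y.
  rewrite addr_ge0 // mulr_ge0 //.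
  - by rewrite big_seq sumr_ge0 // => b bl; rewrite C0 // in_cons bl orbT.
  - by rewrite divr_ge0 // sqr_ge0.
  - by rewrite mulr_ge0 // expR_ge0.
have -> : H (zero_on (a :: l) phi) + X + (size l).+1%:R * (J * expR (- (eps / 2 * M))) =
   (H (zero_on (a :: l) phi) + Y) + C a * (8 / eps ^+ 2) + J * expR (- (eps / 2 * M)).
  by rewrite /X /Y big_cons -natr1; ring.
(* By induction the inner integral is bounded by a quadratic in the remaining noise on [[-M, M]];
   [Y] collects the contributions of the inner noises. *)
apply: (@laplace_quadratic _ _ _ _ B) => //.
(* Zero noises are within [M], so [H] is there an upper bound of [F >= 0]. *)
- rewrite addr_ge0 // -lee_fin; apply: le_trans (FH _ _ _).
  + by case/andP: (FJ (zero_on (a :: l) phi)).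
  + by move=> b bl; rewrite /zero_on bl normr0 ltW.
  + by move=> b bl; rewrite /zero_on (negPf bl).
- exact: C0 (mem_head _ _).
- by move=> y; apply: noiseInt_ge0 => psi; case/andP: (FJ psi).
- move=> y yM; apply: le_trans (IH _ ul _ _ _) _.
  + by move=> b bl; rewrite C0 // in_cons bl orbT.
  + by move=> psi b bl; apply: HB; rewrite in_cons bl orbT.
  + move=> psi h1 h2; apply: FH => b; rewrite in_cons.
      case/orP => [/eqP ->|]; last exact: h1.
      by rewrite h2 // eqxx.
    by rewrite negb_or => /andP [/negPf ba bl]; rewrite h2 // ba.
  + rewrite -/(upd1 phi a y) zE HBa z0 lee_fin /Y; lra.
- by move=> y; apply: noiseInt_le.
Qed.

End Noise.

(** * The potential argument *)

Section Step.
Variables (R : realType) (G : gameTree) (lam : node G -> R).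
Hypothesis hlam : forall u, isLeaf u -> 0 <= lam u <= 1.
Variables (T : nat) (eps : R).
Hypothesis heps : 0 < eps < 1.
Local Notation eta := (etaP G T eps).
Local Notation gamma := (gammaP G T eps).
Hypotheses (eta0 : 0 < eta) (gamma0 : 0 < gamma).
Implicit Types (a : node G) (s t : {ffun node G -> option (node G)}).
Local Notation e2 := (expR 1 - 2 : R).

Let eps0 : 0 < eps. Proof. by case/andP: heps. Qed.

Let e2_ge0 : 0 <= e2.
Proof. by have := @expR1_ge R; lra. Qed.

Lemma lossAct_bounds (m : {ffun node G -> node G}) a : 0 <= lossAct m lam a <= 1.
Proof.
rewrite /lossAct; case: ifP => [/and3P [_ _ /hlam //]|_].
by rewrite lexx ler01.
Qed.

Lemma Loss_bounds (m : {ffun node G -> node G}) s : isEnv m -> s \in Sset G ->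
  0 <= Loss lam s m <= 1.
Proof.
move=> hm sS; have := lossAct_lastAct hm sS lam (lastAct_in hm sS).
by rewrite eqxx => ->; exact: lossAct_bounds.
Qed.

(** * Expected estimates in one trial *)

Section Policy.
Variables (pi : node G -> R) (pol : isPolicy pi).
Local Notation P := (sampleProb pi).
Local Notation q := (pathProb pi).
Let dn a := gamma * beta R a + q a.

Lemma sampleProb_gt0 s : s \in Sset G -> 0 < P s.
Proof.
move=> sS; rewrite sampleProbE //; apply: prodr_gt0 => a.
by rewrite in_Aset_strat => /andP [_]; exact: pol.1.
Qed.

Lemma sampleProb_le1 s : s \in Sset G -> P s <= 1.
Proof.
move=> sS; rewrite -(sum_sampleProb pol.2) (bigD1 s) //= lerDl sumr_ge0 // => t /andP [tS _].
by rewrite ltW // sampleProb_gt0.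
Qed.

Lemma exchange_marginal (g : node G -> R) :
  \sum_(s in Sset G) P s * (\sum_(a in Aσ s) g a) = \sum_(a | isAct a) q a * g a.
Proof.
under eq_bigr => s _ do rewrite mulr_sumr.
rewrite (exchange_big_dep (@isAct G)) /=; last first.
  by move=> s a _; rewrite in_Aset_strat => /andP [].
apply: eq_bigr => a ia; rewrite -mulr_suml -(marginal pol.2 ia); congr (_ * _).
by apply: eq_bigl => s; rewrite in_Aset_strat ia andbT.
Qed.

Lemma exchange_marginal_in s (g : node G -> R) :
  \sum_(t in Sset G) P t * (\sum_(a in Aσ t) (if a \in Aσ s then g a else 0)) =
  \sum_(a in Aσ s) q a * g a.
Proof.
rewrite exchange_marginal big_mkcond [RHS]big_mkcond; apply: eq_bigr => a _.
rewrite in_Aset_strat; case ia : (isAct a); rewrite ?andbF ?andbT //.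
by case: ifP => // _; rewrite mulr0.
Qed.

Let q0 a : 0 < q a. Proof. by apply: pathProb_gt0; exact: pol.1. Qed.

Let dn0 a : isAct a -> 0 < dn a.
Proof. by move=> ia; rewrite addr_gt0 // mulr_gt0 // beta_gt0 // ia orbT. Qed.

Let qdn a : isAct a -> q a / dn a <= 1.
Proof.
move=> ia; rewrite ler_pdivrMr ?dn0 // mul1r lerDr ltW // mulr_gt0 //.
by rewrite beta_gt0 // ia orbT.
Qed.

Variables (m : {ffun node G -> node G}) (hm : isEnv m).
Local Notation loss := (lossAct m lam).

(** The estimated loss of [t] when [s] is sampled and all noises vanish, which is its mean over the
    noise. *)
Let meanLoss s t := \sum_(a in Aσ t) (if a \in Aσ s then loss a / dn a else 0).

(** The coefficient of the squared noise at [a] in the potential bound; see [H_quadratic]. *)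
Let curv a := e2 * eta * (q a / dn a ^+ 2).

(** On average the estimate at an action is its loss times [q / dn <= 1], so the comparator is never
    overcharged. *)
Lemma sum_comparator t : t \in Sset G ->
  \sum_(s in Sset G) P s * meanLoss s t <= Loss lam t m.
Proof.
move=> tS.
rewrite (eq_bigr (fun s => P s * \sum_(a in Aσ s) (if a \in Aσ t then loss a / dn a else 0))).
  rewrite exchange_marginal_in (Loss_sum hm tS); apply: ler_sum => a.
  rewrite in_Aset_strat => /andP [_ ia]; have /andP [l0 _] := lossAct_bounds m a.
  by rewrite mulrCA -[leRHS]mulr1 ler_wpM2l // qdn.
move=> s _; congr (_ * _); rewrite /meanLoss -!big_mkcondr /=.
by apply: eq_bigl => a; rewrite andbC.
Qed.

(** An action contributes [gamma * beta a * loss a * (q a / dn a)], at most [gamma * beta a] and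
    only if it is a candidate; [sum_beta_cand] adds these up. *)
Lemma sum_bias :
  \sum_(s in Sset G) P s * (Loss lam s m - \sum_(t in Sset G) P t * meanLoss s t)
  <= gamma * #|Aset G|%:R.
Proof.
rewrite (eq_bigr (fun s => P s * \sum_(a in Aσ s) (loss a - q a * (loss a / dn a)))).
  rewrite exchange_marginal -(mfun_root G) -(sum_beta_cand R hm) mulr_sumr.
  rewrite [leRHS](_ : _ = \sum_(a | isAct a) (if cand m a then gamma * beta R a else 0)).
    apply: ler_sum => a ia; rewrite /lossAct; case: ifPn => [ca|_]; last first.
      by rewrite mul0r mulr0 subr0 mulr0.
    have /hlam /andP [l0 l1] : isLeaf (m a) by case/and3P: ca.
    have b0 : 0 < gamma * beta R a by rewrite mulr_gt0 // beta_gt0 // ia orbT.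
    have -> : q a * (lam (m a) - q a * (lam (m a) / dn a)) =
        gamma * beta R a * (lam (m a) * (q a / dn a)).
      by have := dn0 ia; rewrite /dn => h; field; rewrite gt_eqF.
    rewrite -[leRHS]mulr1 ler_wpM2l ?(ltW b0) //.
    by rewrite mulr_ile1 // ?qdn // divr_ge0 ?(ltW (q0 _)) // ltW // dn0.
  rewrite -big_mkcondr /=; apply: eq_bigl => a.
  by rewrite /cand; case: (isAct a).
move=> s sS; congr (_ * _); rewrite (Loss_sum hm sS) sumrB; congr (_ - _).
exact: exchange_marginal_in.
Qed.

Lemma sum_curv :
  \sum_(s in Sset G) P s * (\sum_(a in Aσ s) curv a) <= e2 * eta * #|Aset G|%:R.
Proof.
rewrite exchange_marginal -sum1_card natr_sum mulr_sumr.
rewrite [leRHS](eq_bigl (@isAct G)); last by move=> a; rewrite inE.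
apply: ler_sum => a ia.
have -> : q a * curv a = e2 * eta * (q a / dn a) ^+ 2.
  by rewrite /curv; have := dn0 ia => h; field; rewrite gt_eqF.
rewrite ler_wpM2l ?mulr_ge0 ?(ltW eta0) // exprn_ile1 ?qdn //.
by rewrite divr_ge0 ?(ltW (q0 _)) // ltW // dn0.
Qed.

(** Only the last action encountered has a nonzero loss, so the square has no cross terms. The slack
    factor [1 / eps ^+ 2 >= 1] matches the scale of the noise variance. *)
Lemma meanLoss_sqr s t : s \in Sset G ->
  meanLoss s t ^+ 2 <=
  \sum_(a in Aσ t) (if a \in Aσ s then (dn a ^+ 2)^-1 / eps ^+ 2 else 0).
Proof.
move=> sS; set z := lastAct s m.
have zA : z \in Aσ s := lastAct_in hm sS.
have iz : isAct z by move: zA; rewrite in_Aset_strat => /andP [].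
have h0 a : isAct a -> 0 <= (dn a ^+ 2)^-1 / eps ^+ 2.
  by move=> ia; rewrite mulr_ge0 ?invr_ge0 ?sqr_ge0.
have S0 : 0 <= \sum_(a in Aσ t) (if a \in Aσ s then (dn a ^+ 2)^-1 / eps ^+ 2 else 0).
  apply: sumr_ge0 => a; rewrite in_Aset_strat => /andP [_ ia].
  by case: ifP => // _; exact: h0.
have supp a : a \in Aσ s -> a != z -> loss a = 0.
  by move=> aA /negPf az; rewrite -(lossAct_lastAct hm sS lam aA) az.
have [zt|nzt] := boolP (z \in Aσ t); last first.
  rewrite /meanLoss big1 ?expr0n //= => a aA; case: ifP => // as_.
  by rewrite supp ?mul0r //; apply: contraTneq aA => ->.
rewrite /meanLoss (bigD1 z) //= zA big1 ?addr0; last first.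
  by move=> a /andP [aA az]; case: ifP => // as_; rewrite supp ?mul0r.
rewrite [leRHS](bigD1 z) //= zA; apply: le_trans (_ : (dn z ^+ 2)^-1 / eps ^+ 2 <= _).
  rewrite expr_div_n mulrC ler_wpM2l ?invr_ge0 ?sqr_ge0 //.
  have /andP [l0 l1] := lossAct_bounds m z; have /andP [e0 e1] := heps.
  apply: (@le_trans _ _ 1); first exact: exprn_ile1.
  by rewrite invf_ge1 ?exprn_gt0 // exprn_ile1 // ltW.
rewrite lerDl; apply: sumr_ge0 => a /andP []; rewrite in_Aset_strat => /andP [_ ia] _.
by case: ifP => // _; exact: h0.
Qed.

Lemma sum_second_order :
  \sum_(s in Sset G) P s * (\sum_(t in Sset G) P t * (e2 * eta * meanLoss s t ^+ 2))
  <= e2 * eta / eps ^+ 2 * #|Aset G|%:R.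
Proof.
have k0 : 0 <= e2 * eta by rewrite mulr_ge0 // ltW.
apply: le_trans (_ : (eps ^+ 2)^-1 * \sum_(s in Sset G) P s * (\sum_(a in Aσ s) curv a) <= _).
  rewrite mulr_sumr; apply: ler_sum => s sS; rewrite mulrCA ler_wpM2l ?(ltW (sampleProb_gt0 sS)) //.
  apply: le_trans (_ : \sum_(t in Sset G) P t * (e2 * eta *
     \sum_(a in Aσ t) (if a \in Aσ s then (dn a ^+ 2)^-1 / eps ^+ 2 else 0)) <= _).
    apply: ler_sum => t tS; rewrite ler_wpM2l ?(ltW (sampleProb_gt0 tS)) //.
    by rewrite ler_wpM2l // meanLoss_sqr.
  under eq_bigr => t _ do rewrite mulrCA.
  rewrite -mulr_sumr exchange_marginal_in !mulr_sumr.
  by apply: ler_sum => a _; rewrite /curv le_eqVlt; apply/orP; left; apply/eqP; ring.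
rewrite mulrAC [leRHS]mulrC ler_wpM2l ?invr_ge0 ?sqr_ge0 //; exact: sum_curv.
Qed.

(** The constant [9] is [1] from [sum_second_order] plus [8] from the noise variance; [gamma] is the
    bias, and [J] is paid once per sampled action. *)
Lemma sum_step s0 (W J : R) : s0 \in Sset G -> 0 <= J ->
  \sum_(s in Sset G) P s * (Loss lam s m +
    (W + meanLoss s s0 + (\sum_(t in Sset G) P t * (- meanLoss s t + e2 * eta * meanLoss s t ^+ 2))
     + (\sum_(a in Aσ s) curv a) * (8 / eps ^+ 2) + #|Aσ s|%:R * J)) <=
  Loss lam s0 m + W + #|Aset G|%:R * (gamma + 9 * e2 * eta / eps ^+ 2 + J).
Proof.
move=> s0S J0.
have e20 : 0 < eps ^+ 2 by rewrite exprn_gt0.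
pose A := \sum_(s in Sset G) P s * meanLoss s s0.
pose B := \sum_(s in Sset G) P s * (Loss lam s m - \sum_(t in Sset G) P t * meanLoss s t).
pose C := \sum_(s in Sset G) P s * (\sum_(t in Sset G) P t * (e2 * eta * meanLoss s t ^+ 2)).
pose D := \sum_(s in Sset G) P s * (\sum_(a in Aσ s) curv a).
pose E := \sum_(s in Sset G) P s * #|Aσ s|%:R.
have -> : \sum_(s in Sset G) P s * (Loss lam s m +
    (W + meanLoss s s0 + (\sum_(t in Sset G) P t * (- meanLoss s t + e2 * eta * meanLoss s t ^+ 2))
     + (\sum_(a in Aσ s) curv a) * (8 / eps ^+ 2) + #|Aσ s|%:R * J)) =
    W + A + B + C + D * (8 / eps ^+ 2) + E * J.
  transitivity (\sum_(s in Sset G) P s * W + A + B + C +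
    \sum_(s in Sset G) P s * ((\sum_(a in Aσ s) curv a) * (8 / eps ^+ 2)) +
    \sum_(s in Sset G) P s * (#|Aσ s|%:R * J)); last first.
    rewrite -mulr_suml sum_sampleProb ?mul1r; last exact: pol.2.
    by rewrite /D /E 2!mulr_suml; congr (_ + _ + _); apply: eq_bigr => s _; rewrite mulrA.
  rewrite /A /B /C -!big_split /=.
  apply: eq_bigr => s _.
  have -> : \sum_(t in Sset G) P t * (- meanLoss s t + e2 * eta * meanLoss s t ^+ 2) =
    - (\sum_(t in Sset G) P t * meanLoss s t) +
    \sum_(t in Sset G) P t * (e2 * eta * meanLoss s t ^+ 2).
    by rewrite -sumrN -big_split /=; apply: eq_bigr => t _; ring.
  ring.
have hE : E <= #|Aset G|%:R.
  apply: le_trans (_ : \sum_(s in Sset G) P s * #|Aset G|%:R <= _); last first.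
    by rewrite -mulr_suml sum_sampleProb ?mul1r //; exact: pol.2.
  apply: ler_sum => s sS.
  rewrite ler_wpM2l ?(ltW (sampleProb_gt0 sS)) // ler_nat; apply: subset_leq_card.
  by apply/fintype.subsetP => a; rewrite in_Aset_strat => /andP [_ ia]; rewrite inE.
have hA := sum_comparator s0S; have hB := sum_bias; have hC := sum_second_order.
have hD := sum_curv; rewrite -/A in hA; rewrite -/B in hB; rewrite -/C in hC; rewrite -/D in hD.
have hD' : D * (8 / eps ^+ 2) <= e2 * eta * #|Aset G|%:R * (8 / eps ^+ 2).
  by rewrite ler_wpM2r // divr_ge0 // ltW.
have hE' : E * J <= #|Aset G|%:R * J by rewrite ler_wpM2r.
have -> : Loss lam s0 m + W + #|Aset G|%:R * (gamma + 9 * e2 * eta / eps ^+ 2 + J) =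
  W + Loss lam s0 m + gamma * #|Aset G|%:R + e2 * eta / eps ^+ 2 * #|Aset G|%:R +
  e2 * eta * #|Aset G|%:R * (8 / eps ^+ 2) + #|Aset G|%:R * J.
  by field; rewrite gt_eqF.
lra.
Qed.

(** * Dependence of the potential on the noises *)

Section Noisy.
Variables (s s0 : {ffun node G -> option (node G)}) (sS : s \in Sset G) (s0S : s0 \in Sset G).

Let d (phi : node G -> R) a := (if a == lastAct s m then Loss lam s m else 0) + phi a.
Let est phi t := \sum_(a in Aσ t) estLoss T eps pi s (d phi) a.
(** The bound of [potential_step] as a polynomial in the noises; [W] stands for the terms that do
    not involve the estimates. *)
Let H W phi := W + est phi s0 +
  \sum_(t in Sset G) P t * (- est phi t + e2 * eta * est phi t ^+ 2).

Lemma est0 t : est (fun => 0) t = meanLoss s t.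
Proof.
apply: eq_bigr => a _; rewrite /estLoss; case: ifP => // aA.
by rewrite /d addr0 (lossAct_lastAct hm sS lam aA).
Qed.

Let slope a t := if a \in Aσ t then (dn a)^-1 else 0.

Lemma est_upd phi a y t : a \in Aσ s ->
  est (upd1 phi a y) t = est (upd1 phi a 0) t + slope a t * y.
Proof.
move=> aA; rewrite /est /slope; have [aT|naT] := boolP (a \in Aσ t); last first.
  rewrite mul0r addr0; apply: eq_bigr => b bT; rewrite /estLoss /d /upd1.
  by have -> : (b == a) = false by apply: contraNF naT => /eqP <-.
rewrite (bigD1 a) //= [in RHS](bigD1 a) //= addrAC; congr (_ + _).
  rewrite /estLoss aA /d /upd1 eqxx -/(dn a) addr0 mulrDl; congr (_ + _).
  by rewrite mulrC.
by apply: eq_bigr => b /andP [_ /negPf ba]; rewrite /estLoss /d /upd1 ba.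
Qed.

Lemma H_quadratic W phi a : a \in Aσ s -> exists B, forall y,
  H W (upd1 phi a y) = H W (upd1 phi a 0) + B * y + curv a * y ^+ 2.
Proof.
move=> aA; have ia : isAct a by move: aA; rewrite in_Aset_strat => /andP [].
(* The derivative in [y] at [0]. *)
exists (slope a s0 + \sum_(t in Sset G) P t *
  (- slope a t + 2 * (e2 * eta) * est (upd1 phi a 0) t * slope a t)) => y.
have -> : curv a = \sum_(t in Sset G) P t * (e2 * eta * slope a t ^+ 2).
  rewrite /curv -(marginal pol.2 ia) mulr_suml mulr_sumr big_mkcondr /=; apply: eq_bigr => t _.
  rewrite /slope in_Aset_strat ia andbT; case: ifP => _; last by rewrite expr0n /= !mulr0.
  by rewrite exprVn; ring.
have E1 : \sum_(t in Sset G) P t * (- est (upd1 phi a y) t + e2 * eta * est (upd1 phi a y) t ^+ 2) =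
    \sum_(t in Sset G) P t * (- est (upd1 phi a 0) t + e2 * eta * est (upd1 phi a 0) t ^+ 2) +
    (\sum_(t in Sset G) P t *
      (- slope a t + 2 * (e2 * eta) * est (upd1 phi a 0) t * slope a t)) * y +
    (\sum_(t in Sset G) P t * (e2 * eta * slope a t ^+ 2)) * y ^+ 2.
  rewrite !mulr_suml -!big_split /=; apply: eq_bigr => t _.
  by rewrite (est_upd _ _ _ aA); ring.
by rewrite /H E1 (est_upd _ _ _ aA); ring.
Qed.

(* The weights [beta] are tuned so that the losses estimated along any strategy
   sum to at least [-1 / eta] whenever all noises are at least [- gamma / eta]. *)
Lemma est_ge phi t : t \in Sset G ->
  (forall a, a \in Aσ s -> - (gamma / eta) <= phi a) -> - (eta * est phi t) <= 1.
Proof.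
move=> tS hphi; rewrite -(sum_inv_beta R tS) /est mulr_sumr -sumrN.
apply: ler_sum => a; rewrite in_Aset_strat => /andP [_ ia].
have b0 : 0 < beta R a by rewrite beta_gt0 // ia orbT.
rewrite /estLoss; case: ifPn => [aA|_]; last by rewrite mulr0 oppr0 invr_ge0 ltW.
rewrite -/(dn a) mulrA -mulNr ler_pdivrMr ?dn0 //.
have hd : - gamma <= eta * d phi a.
  have h1 := hphi _ aA.
  have h2 : - (gamma / eta) <= d phi a.
    apply: le_trans h1 _; rewrite /d lerDr.
    by case: ifP => // _; case/andP: (Loss_bounds hm sS).
  have -> : - gamma = eta * - (gamma / eta) by field; rewrite gt_eqF.
  by rewrite ler_pM2l.
apply: le_trans (_ : gamma <= _); first by rewrite lerNl.
rewrite /dn mulrDr mulrCA mulVf ?mulr1 ?gt_eqF //.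
by rewrite lerDl mulr_ge0 ?invr_ge0 // ltW.
Qed.

(** The potential changes by [est phi s0 + ln Z / eta], where [ln Z <= Z - 1] and each exponential
    in [Z] is bounded by [expR_le_quadratic], applicable by [est_ge]. *)
Lemma potential_step phi : (forall a, a \in Aσ s -> - (gamma / eta) <= phi a) ->
  - ln (sampleProb (newPolicy T eps pi s (d phi)) s0) / eta <=
  - ln (P s0) / eta + est phi s0 +
  \sum_(t in Sset G) P t * (- est phi t + e2 * eta * est phi t ^+ 2).
Proof.
move=> hphi.
have Z0 := updZ_gt0 T eps (d phi) pol sS (root G).
set Z := updZ _ _ _ _ _ _ in Z0.
have ZE : Z = \sum_(t in Sset G) P t * expR (- (eta * est phi t)).
  exact: updZ_root.
have hZ : ln Z <= \sum_(t in Sset G) P t * (- (eta * est phi t) + e2 * (eta * est phi t) ^+ 2).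
  apply: (@le_trans _ _ (Z - 1)).
    rewrite -ler_expR lnK ?posrE //.
    by apply: le_trans (expR_ge1Dx _); rewrite addrCA subrr addr0.
  rewrite ZE -[X in _ - X <= _](sum_sampleProb pol.2) -sumrB; apply: ler_sum => t tS.
  rewrite -[X in _ - X]mulr1 -mulrBr ler_wpM2l ?(ltW (sampleProb_gt0 tS)) //.
  have := expR_le_quadratic (est_ge tS hphi); rewrite sqrrN; lra.
rewrite sampleProb_new // -/Z -/(est phi s0).
have Ps := sampleProb_gt0 s0S.
rewrite ln_div ?lnM ?posrE ?mulr_gt0 ?expR_gt0 // expRK.
have hX : (\sum_(t in Sset G) P t * (- est phi t + e2 * eta * est phi t ^+ 2)) * eta =
    \sum_(t in Sset G) P t * (- (eta * est phi t) + e2 * (eta * est phi t) ^+ 2).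
  by rewrite mulr_suml; apply: eq_bigr => t _; ring.
rewrite -hX in hZ; move: hZ; set X := \sum_(t in _) _; move=> hZ.
have n0 : eta != 0 by rewrite gt_eqF.
have -> : - ln (P s0) / eta + est phi s0 + X =
  (- ln (P s0) + est phi s0 * eta + X * eta) / eta by field.
have i0 : 0 < eta^-1 by rewrite invr_gt0.
by rewrite ler_pM2r //; lra.
Qed.

(** [noiseInt_quadratic] with [M = gamma / eta], the threshold of [est_ge]; beyond it only the crude
    bound [J] is used. *)
Lemma noise_step (W J : R) (F : (node G -> R) -> \bar R) : 0 <= J ->
  (forall phi, 0 <= F phi <= J%:E)%E ->
  (forall phi, F phi <=
     (W - ln (sampleProb (newPolicy T eps pi s (d phi)) s0) / eta)%:E)%E ->
  (noiseInt eps (enum (Aσ s)) F (fun => 0%R) <=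
   (W - ln (P s0) / eta + meanLoss s s0 +
    (\sum_(t in Sset G) P t * (- meanLoss s t + e2 * eta * meanLoss s t ^+ 2)) +
    (\sum_(a in Aσ s) curv a) * (8 / eps ^+ 2) +
    #|Aσ s|%:R * (J * expR (- (eps / 2 * (gamma / eta)))))%:E)%E.
Proof.
move=> J0 FJ FW; pose W' := W - ln (P s0) / eta.
have M0 : 0 < gamma / eta by rewrite divr_gt0.
have := @noiseInt_quadratic G R eps eps0 (enum (Aσ s)) F (H W') curv J (gamma / eta)
  (fun => 0) (enum_uniq _) M0 J0.
have -> : zero_on (enum (Aσ s)) (fun=> 0 : R) = (fun=> 0).
  by apply/funext => c; rewrite /zero_on; case: ifP.
rewrite big_enum -cardE /H est0.
rewrite (eq_bigr (fun t => P t * (- meanLoss s t + e2 * eta * meanLoss s t ^+ 2))).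
  apply => //.
  - move=> a; rewrite mem_enum in_Aset_strat => /andP [_ ia].
    apply: mulr_ge0; first by rewrite mulr_ge0 // ltW.
    by rewrite divr_ge0 ?sqr_ge0 // ltW.
  - by move=> phi a; rewrite mem_enum; exact: H_quadratic.
  - move=> phi h _; apply: le_trans (FW phi) _; rewrite lee_fin.
    have : forall a, a \in Aσ s -> - (gamma / eta) <= phi a.
      by move=> a aA; have := h a; rewrite mem_enum ler_norml => /(_ aA) /andP [].
    by move=> /potential_step; rewrite /W' mulNr; lra.
by move=> t _; rewrite est0.
Qed.

End Noisy.
End Policy.

(** * Induction over the trials *)

Section Induction.
Variables (mu : nat -> {ffun node G -> node G}) (hmu : forall i, isEnv (mu i)).
Local Notation eloss := (expLossF lam T eps mu).
Hypothesis noise_tail : expR (- (eps / 2 * (gamma / eta))) <= (T%:R ^+ 3)^-1.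
Hypothesis T0 : (0 < T)%N.

Lemma expLossF_le j i pi (B : {ffun node G -> option (node G)} -> R) : isPolicy pi ->
  (forall s, s \in Sset G -> (noiseInt eps (enum (Aσ s)) (fun phi =>
       eloss j i.+1 (newPolicy T eps pi s (fun a =>
         (if a == lastAct s (mu i) then Loss lam s (mu i) else 0) + phi a)%R))
     (fun => 0%R) <= (B s)%:E)%E) ->
  (eloss j.+1 i pi <=
   (\sum_(s in Sset G) sampleProb pi s * (Loss lam s (mu i) + B s))%:E)%E.
Proof.
move=> pol hB; rewrite /= -sumEFin; apply: lee_sum => s sS.
rewrite EFinM; apply: lee_wpmul2l; first by rewrite lee_fin ltW // sampleProb_gt0.
by rewrite EFinD; apply: leeD2l; exact: hB.
Qed.

Lemma expLossF_bounds j i pi : isPolicy pi -> (0 <= eloss j i pi <= j%:R%:E)%E.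
Proof.
elim: j i pi => [|j IH] i pi pol; first by rewrite /= lexx.
have FJ s phi : s \in Sset G -> (0 <= eloss j i.+1 (newPolicy T eps pi s phi) <= j%:R%:E)%E.
  by move=> sS; apply: IH; exact: newPolicy_policy.
apply/andP; split.
  apply: sume_ge0 => s sS; apply: mule_ge0; first by rewrite lee_fin ltW // sampleProb_gt0.
  apply: adde_ge0; first by rewrite lee_fin; case/andP: (Loss_bounds (hmu i) sS).
  by apply: noiseInt_ge0 => // phi; case/andP: (FJ _ (fun a =>
    (if a == lastAct s (mu i) then Loss lam s (mu i) else 0) + phi a) sS).
apply: le_trans (@expLossF_le _ _ _ (fun => j%:R) pol _) _.
  by move=> s sS; apply: noiseInt_le => // phi; exact: FJ.
rewrite lee_fin; apply: le_trans (_ : \sum_(s in Sset G) sampleProb pi s * j.+1%:R <= _).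
  apply: ler_sum => s sS; rewrite ler_wpM2l ?(ltW (sampleProb_gt0 _ sS)) //.
  by have /andP [_ h] := Loss_bounds (hmu i) sS; rewrite -natr1; lra.
by rewrite -mulr_suml sum_sampleProb ?mul1r //; exact: pol.2.
Qed.

(** The cost of one trial. The summand [1 / T^2] is the tail probability [1 / T^3] times a remaining
    loss of at most [T]. *)
Definition regretRate : R :=
  #|Aset G|%:R * (gamma + 9 * e2 * eta / eps ^+ 2 + (T%:R ^+ 2)^-1).

(** Induction on the number [j] of remaining trials, for all policies at once. When no trial is left
    the potential is nonnegative, since a probability is at most [1]. *)
Lemma expLossF_regret s0 j i pi : s0 \in Sset G -> isPolicy pi -> (j <= T)%N ->
  (eloss j i pi <= (\sum_(i <= k < i + j) Loss lam s0 (mu k)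
     - ln (sampleProb pi s0) / eta + j%:R * regretRate)%:E)%E.
Proof.
move=> s0S; elim: j i pi => [|j IH] i pi pol jT.
  rewrite /= addn0 big_geq // add0r mul0r addr0 lee_fin oppr_ge0.
  by rewrite ler_pdivrMr // mul0r; apply: ln_le0; exact: sampleProb_le1.
pose W := \sum_(i.+1 <= k < i.+1 + j) Loss lam s0 (mu k) + j%:R * regretRate.
apply: le_trans (expLossF_le pol _) _.
  move=> s sS; apply: (@noise_step pi pol (mu i) (hmu i) s s0 sS s0S W j%:R) => // phi.
    exact/expLossF_bounds/newPolicy_policy.
  apply: le_trans (IH _ _ _ _) _ => //; first exact: newPolicy_policy.
    exact: ltnW.
  by rewrite lee_fin /W; lra.
rewrite lee_fin; apply: (le_trans (@sum_step pi pol (mu i) (hmu i) s0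
  (W - ln (sampleProb pi s0) / eta) (j%:R * expR (- (eps / 2 * (gamma / eta)))) s0S _)).
  by rewrite mulr_ge0 ?expR_ge0.
rewrite addnS big_ltn ?ltnS ?leq_addr //.
have hJ : j%:R * expR (- (eps / 2 * (gamma / eta))) <= (T%:R ^+ 2)^-1.
  apply: le_trans (_ : T%:R * (T%:R ^+ 3)^-1 <= _).
    by rewrite ler_pM ?ler0n ?expR_ge0 // ler_nat ltnW.
  by rewrite exprS invfM mulrA divff ?mul1r // pnatr_eq0 -lt0n.
rewrite /W addSn -natr1 /regretRate.
have : 0 <= #|Aset G|%:R :> R by [].
move: (#|Aset G|%:R : R) => A A0; nra.
Qed.

End Induction.
End Step.

(** * The regret bound for the tuned parameters *)

Lemma ln_nat_ge_half (R : realType) n : (2 <= n)%N -> 2^-1 <= ln (n%:R : R).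
Proof.
move=> n2; have n0 : 0 < n%:R :> R by rewrite ltr0n; lia.
rewrite -ler_expR lnK ?posrE //.
have h1 := expR_gt0 (2^-1 : R).
have h2 : expR (2^-1 : R) * expR (- 2^-1) = 1 by rewrite -expRD subrr expR0.
(* From [exp (- 1/2) >= 1/2] follows [exp (1/2) <= 2]. *)
have h3 := expR_ge1Dx (- 2^-1 : R).
apply: (@le_trans _ _ 2); last by rewrite ler_nat.
by nra.
Qed.

Lemma le_minLoss (R : realType) (G : gameTree) (lam : node G -> R) T mu (c : R) :
  (forall s, s \in Sset G -> c <= \sum_(1 <= t < T.+1) Loss lam s (mu t)) ->
  (c%:E <= minLoss lam T mu)%E.
Proof.
move=> h; rewrite /minLoss; elim/big_ind: _ => [|x y hx hy|s sS].
- by rewrite leey.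
- by rewrite le_min hx hy.
- by rewrite lee_fin h.
Qed.

Theorem theorem1 (R : realType) (G : gameTree) (lam : node G -> R)
  (hlam : forall u, isLeaf u -> 0 <= lam u <= 1)
  (T : nat) (hT : (1 <= T)%N) (eps : R) (heps : 0 < eps < 1)
  (mu : nat -> {ffun node G -> node G}) (hmu : forall t, isEnv (mu t)) :
  (expLoss lam T eps mu - minLoss lam T mu
   <= (1 + 2 * Num.sqrt ((6 * ln T%:R / eps + 9 * (expR 1 - 2) / eps ^+ 2)
                         * #|Aset G|%:R * ln (#|Sset G|%:R) * T%:R))%:E)%E.
Proof.
have /andP [e0 e1] := heps.
have pol1 : isPolicy (@pi1 G R).
  by split; [move=> a _; exact: pi1_gt0|exact: normalized_pi1].
have T0 : 0 < T%:R :> R by rewrite ltr0n.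
have lT0 : 0 <= ln (T%:R : R) by apply: ln_ge0; rewrite ler1n.
pose X : R := 6 * ln T%:R / eps + 9 * (expR 1 - 2) / eps ^+ 2.
pose A : R := #|Aset G|%:R.
pose L : R := ln (#|Sset G|%:R).
have A1 : 1 <= A by rewrite /A -mfun_root ler1n mfun_gt0.
have L0 : 2^-1 <= L by apply: ln_nat_ge_half; rewrite (card_Sset G R) nfun_root_gt1.
have X0 : 9 / 2 <= X.
  have h1 : 0 <= 6 * ln T%:R / eps by rewrite divr_ge0 ?mulr_ge0 // ltW.
  have h2 : 1 <= (eps ^+ 2)^-1 by rewrite invf_ge1 ?exprn_gt0 // exprn_ile1 // ltW.
  have h3 := @expR1_ge R; rewrite /X; nra.
set Bd := 1 + 2 * Num.sqrt _.
have BdE : Bd = 1 + 2 * Num.sqrt (X * A * L * T%:R) by [].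
have bounds : (0 <= expLoss lam T eps mu <= T%:R%:E)%E by exact: expLossF_bounds.
have min0 : (0%:E <= minLoss lam T mu)%E.
  apply: le_minLoss => s sS; apply: sumr_ge0 => t _.
  by case/andP: (Loss_bounds hlam (hmu t) sS).
(* A bound of at least [T] is trivial, since the expected loss is at most [T] and the comparator
   loss is nonnegative. *)
have [TB|BT] := lerP T%:R Bd.
  rewrite -[leRHS]sube0; apply: leeB => //.
  by case/andP: bounds => _ h; apply: le_trans h _; rewrite lee_fin.
have sq0 := sqrtr_ge0 (X * A * L * T%:R).
(* If [A > T], then [X * L >= 9/4] makes the square root at least [3/2 * T], so the bound would
   exceed [T]. *)
have AT : A <= T%:R.
  rewrite leNgt; apply/negP => TA.
  have : T%:R <= 2 * Num.sqrt (X * A * L * T%:R); last by lra.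
  rewrite -(@ler_pXn2r _ 2) ?nnegrE ?mulr_ge0 // ?(ltW T0) //.
  rewrite exprMn sqr_sqrtr; last by rewrite !mulr_ge0 //; lra.
  have h1 : T%:R * T%:R <= A * T%:R by rewrite ler_wpM2r // ltW.
  have h2 : 9 / 4 <= X * L by nra.
  have h3 : 0 <= A * T%:R by rewrite mulr_ge0 //; lra.
  have -> : X * A * L * T%:R = (X * L) * (A * T%:R) by ring.
  by nra.
(* [T > Bd >= 1], so [ln T], and with it [gamma], is positive. *)
have T2 : 1 < T%:R :> R by lra.
have lT : 0 < ln (T%:R : R) by apply: ln_gt0.
(* [S] is the inverse of [eta]. The initial potential [S * L] and the accumulated cost
   [X * A * T / S] both equal [sqrt (X * A * L * T)], whence the factor [2]. *)
pose S := Num.sqrt (X * A * T%:R / L).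
have Q0 : 0 < X * A * T%:R / L by rewrite divr_gt0 ?mulr_gt0 //; lra.
have S0 : 0 < S by rewrite sqrtr_gt0.
have S2 : S ^+ 2 = X * A * T%:R / L by rewrite sqr_sqrtr // ltW.
have etaE : etaP G T eps = S^-1.
  by rewrite /etaP mfun_root -(card_Sset G R).
have eta0 : 0 < etaP G T eps by rewrite etaE invr_gt0.
have gamma0 : 0 < gammaP G T eps by rewrite divr_gt0 ?mulr_gt0.
have tail : expR (- (eps / 2 * (gammaP G T eps / etaP G T eps))) <= (T%:R ^+ 3)^-1.
  (* The constant [6] in [gamma] is chosen to make this exponent [3 * ln T]. *)
  have -> : eps / 2 * (gammaP G T eps / etaP G T eps) = 3%:R * ln T%:R.
    by rewrite /gammaP; field; rewrite !gt_eqF.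
  by rewrite expRN expRM_natl lnK // posrE.
have reg s : s \in Sset G -> (expLoss lam T eps mu <=
    (\sum_(1 <= t < T.+1) Loss lam s (mu t) + Bd)%:E)%E.
  move=> sS; apply: (le_trans
    (expLossF_regret hlam heps eta0 gamma0 hmu tail hT 1 sS pol1 (leqnn T))).
  rewrite lee_fin add1n -addrA lerD2l sampleProb_pi1 // -(card_Sset G R) lnV ?posrE; last first.
    by rewrite (card_Sset G R) ltr0n nfun_gt0.
  rewrite -/L etaE invrK mulNr opprK /regretRate etaE -/A /gammaP etaE.
  have Ln0 : L != 0 by rewrite gt_eqF //; lra.
  have Sn0 : S != 0 by rewrite gt_eqF.
  have en0 : eps != 0 by rewrite gt_eqF.
  have Tn0 : T%:R != 0 :> R by rewrite gt_eqF.
  have hXS : X * A * T%:R = S ^+ 2 * L by rewrite S2 divfK.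
  have hB : Bd = 1 + 2 * (S * L).
    rewrite BdE (_ : X * A * L * T%:R = (S * L) ^+ 2); last first.
      by rewrite exprMn [L ^+ 2]expr2 mulrA -hXS; ring.
    by rewrite sqrtr_sqr ger0_norm // mulr_ge0 ?ltW //; lra.
  (* The total cost of large noises, which is the summand [1] of the bound. *)
  have h1 : A / T%:R <= 1 by rewrite ler_pdivrMr // mul1r.
  have h2 : T%:R * (A * (6 * ln T%:R * S^-1 / eps + 9 * (expR 1 - 2) * S^-1 / eps ^+ 2 +
      (T%:R ^+ 2)^-1)) = X * A * T%:R / S + A / T%:R.
    by rewrite /X; field; rewrite Tn0 Sn0 en0.
  rewrite h2 hXS hB.
  have -> : S ^+ 2 * L / S = S * L by field.
  by lra.
(* Finiteness of the expected loss allows the subtraction to be rearranged in the reals. *)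
have [x xE] : exists x : R, expLoss lam T eps mu = x%:E.
  case/andP: bounds; case: (expLoss _ _ _ _) => [x _ _|//|//].
  by exists x.
have hmin : ((x - Bd)%:E <= minLoss lam T mu)%E.
  by apply: le_minLoss => s sS; have := reg s sS; rewrite xE lee_fin; lra.
move: hmin; rewrite xE; case: (minLoss _ _ _) => [y| |] //=.
  by rewrite !lee_fin; lra.
by rewrite leNye.
Qed.
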